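(* Let $d=1$ and let $F$, the partitions $\{A_j^m(x)\}_{j=0}^m$, the functions $h_m(x),\delta_m(x),\sigma_m(x),\sigma_0(x)>0$ and the model $p(y|x,\mathcal{M}_4)$ be as described in the context. Suppose: 1. For some $p_m\in(0,m^{-1}]$ not depending on $x$: $F(A_j^m(x)|x)=p_m$ for $j>0$, $F(A_0^m(x)|x)=1-mp_m$, and $mp_m\to1$; and for each $x$, as $m\to\infty$, $\delta_m(x)\to0$, $\sigma_m(x)/\delta_m(x)\to0$, $h_m(x)/\sigma_m(x)\to0$. 2. $f(y|x)$ is continuous in $y$ a.s. $F$. 3. For any $(y,x)$ there exists an interval $C(r(x),y,x)$ with length $r(x)>0$ and $y\in C(r(x),y,x)$ such that (i) $$\int\log\frac{f(y|x)}{\inf_{z\in C(r(x),y,x)}f(z|x)}F(dy,dx)<\infty$$ and (ii) there exists $M$ such that for any $m\ge M$: if $y\in A_0^m(x)$, then $C(r(x),y,x)\cap A_0^m(x)$ contains an interval $C_0(r(x),y,x)$ with an end at $y$ and length $r(x)/2$; and if $y\in Y\setminus A_0^m(x)$, then $C(r(x),y,x)\cap(Y\setminus A_0^m(x))$ contains an interval $C_1(r(x),y,x)$ with an end at $y$ and length $r(x)/2$. 4. $\sup_x\sigma_m(x)/r(x)\to0$ and $\sup_x h_m(x)/\sigma_m(x)\to0$. 5. $1>1/4\ge\phi(y,0,\sigma_0(x))\,r(x)/2$ (which holds, for example, when $\sigma_0(x)\ge2(2\pi)^{-1/2}r(x)$). 6. $\big|\int\log[\phi(y,0,\sigma_0(x))\,r(x)/2]\,F(dy,dx)\big|<\infty$.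 Then $d_{\mathrm{KL}}(F,\mathcal{M}_4)\to0$ as $m\to\infty$.
   Context: $F$ is a probability distribution on $Y\times X$, $Y\subset\mathbb{R}$, $X\subset\mathbb{R}^{d_x}$. The conditional distribution of $y$ given $x$ has a density $f(y|x)$ with respect to Lebesgue measure $\lambda$; the marginal of $x$ has a density $f(x)$ with respect to some generic measure. $F(A|x)=\int_A f(y|x)\,dy$. $\phi(y,\mu,\sigma)$ is the density at $y$ of the normal distribution with mean $\mu$ and standard deviation $\sigma$. For a model $\mathcal{M}$ with conditional density $p(y|x,\mathcal{M})$, $$d_{\mathrm{KL}}(F,\mathcal{M})=\int\log\frac{f(y|x)}{p(y|x,\mathcal{M})}\,F(dy,dx).$$ For each $x$ and $m$, $A_j^m(x)$, $j=0,1,\dots,m$, is a partition of $Y$ such that $A_1^m(x),\dots,A_m^m(x)$ are intervals and $\bigcup_{j=1}^mA_j^m(x)$ is an interval that is nondecreasing in $m$. $h_m(x)$ is an upper bound on interval length: $h_m(x)\ge\max_{j>0}\lambda(A_j^m(x))$. $\mu_j^m(x)\in A_j^m(x)$ for $j>0$. $\sigma_0(x)$ does not depend on $m$. The model is $$p(y|x,\mathcal{M}_4)=\sum_{j=1}^mF(A_j^m(x)|x)\,\phi(y,\mu_j^m(x),\sigma_m(x))+F(A_0^m(x)|x)\,\phi(y,0,\sigma_0(x)).$$ *)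

(* Defs.v *)
From HB Require Import structures.
From mathcomp Require Import all_boot all_order all_algebra.
From mathcomp Require Import all_classical all_reals all_analysis.
From mathcomp Require Import measurable_realfun.

Set Implicit Arguments.
Unset Strict Implicit.
Unset Printing Implicit Defensive.

Import Order.TTheory GRing.Theory Num.Theory.
Import numFieldNormedType.Exports.

Local Open Scope classical_set_scope.
Local Open Scope ring_scope.

Section definitions.
Context {R : realType} {dx : nat}.

Implicit Types (Y A I : set R) (X : set (dx.-tuple R)) (x : dx.-tuple R).
Implicit Types (F : probability (R * dx.-tuple R)%type R).
Implicit Types (f : R -> dx.-tuple R -> R).

(* F(A | x), for the conditional density f y x = f(y | x) *)
Definition cond_prob f A x : \bar R :=
  (\int[lebesgue_measure]_(y in A) (f y x)%:E)%E.

(* The densities f(. | x) of the conditional distributions on Y are taken on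
   the whole real line, with value 0 outside Y. *)
Definition conditional_density F Y X f : Prop :=
  [/\ forall y x, X x -> 0 <= f y x,
      forall y x, X x -> ~ Y y -> f y x = 0,
      forall x, X x -> cond_prob f setT x = 1%E,
      measurable_fun (setT `*` X) (fun z => f z.1 z.2) &
      forall A (B : set (dx.-tuple R)), measurable A -> measurable B ->
        B `<=` X ->
        F (A `*` B) = (\int[pushforward F snd]_(x in B) cond_prob f A x)%E].

Definition marginal_density F X (nu : {measure set (dx.-tuple R) -> \bar R})
    (fX : dx.-tuple R -> R) : Prop :=
  [/\ forall x, X x -> 0 <= fX x,
      measurable_fun X fX &
      forall B, measurable B -> B `<=` X ->
        pushforward F snd B = (\int[nu]_(x in B) (fX x)%:E)%E].

(* The logarithm and the quotient are those of the extended reals, with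
   c / 0 = +oo for c > 0, so that p = 0 < f on a set of positive probability
   makes the divergence infinite. *)
Definition dKL F Y X f (p : R -> dx.-tuple R -> \bar R) : \bar R :=
  (\int[F]_(z in Y `*` X) lne ((f z.1 z.2)%:E / p z.1 z.2))%E.

(* A m j x stands for A_j^m(x); only the indices m >= 1 and j <= m matter.
   Cells may be empty: A_0^m(x) is, for instance, when the other cells cover
   Y. The predicate [partition] of the library would exclude this. *)
Definition interval_partitions Y X (A : nat -> nat -> dx.-tuple R -> set R)
    : Prop :=
  [/\ forall m x, (0 < m)%N -> X x ->
        \bigcup_(j in [set j | (j <= m)%N]) A m j x = Y,
      forall m x, (0 < m)%N -> X x ->
        trivIset [set j | (j <= m)%N] (fun j => A m j x),
      forall m j x, (0 < j <= m)%N -> X x -> is_interval (A m j x),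
      forall m x, (0 < m)%N -> X x ->
        is_interval (\bigcup_(j in [set j | (0 < j <= m)%N]) A m j x) &
      forall m n x, (0 < m <= n)%N -> X x ->
        \bigcup_(j in [set j | (0 < j <= m)%N]) A m j x `<=`
        \bigcup_(j in [set j | (0 < j <= n)%N]) A n j x].

Definition model4 f (A : nat -> nat -> dx.-tuple R -> set R)
    (mu : nat -> nat -> dx.-tuple R -> R) (sigma : nat -> dx.-tuple R -> R)
    (sigma0 : dx.-tuple R -> R) (m : nat) (y : R) x : \bar R :=
  (\sum_(1 <= j < m.+1)
      cond_prob f (A m j x) x * (normal_pdf (mu m j x) (sigma m x) y)%:E
   + cond_prob f (A m 0%N x) x * (normal_pdf 0 (sigma0 x) y)%:E)%E.

Definition interval_of_length I (l : R) : Prop :=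
  is_interval I /\ lebesgue_measure I = l%:E.

(* For an interval of finite positive length, inf and sup are its ends. *)
Definition has_end I (y : R) : Prop := y = inf I \/ y = sup I.

End definitions.

(* Main.v *)
Require Import Defs.
From HB Require Import structures.
From mathcomp Require Import all_boot all_order all_algebra.
From mathcomp Require Import all_classical all_reals all_analysis.
From mathcomp Require Import measurable_realfun.
From mathcomp Require Import ring lra.

Set Implicit Arguments.
Unset Strict Implicit.
Unset Printing Implicit Defensive.

Import Order.TTheory GRing.Theory Num.Theory.
Import numFieldNormedType.Exports.

Local Open Scope classical_set_scope.
Local Open Scope ring_scope.

(** Write p_m for the model, L_m for the positive part of log (f / p_m), and U_m(x)
    for the union of the cells of positive index, so that A_0^m(x) is the
    complement of U_m(x) in Y.

    In each slice x the model has total mass at most 1 on Y, so by Gibbs'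
    inequality ([gibbs]) the negative part of log (f / p_m) integrates to no more
    than L_m.  Hence the divergence lies between 0 and the integral of L_m, and
    only the latter has to be shown to vanish.  By [disintegration] it is the
    integral over x of the slice integrals of L_m(., x) f(. | x), and dominated
    convergence in x applies once these tend to 0 for almost every x
    ([log_excess_cvg0]) and are dominated ([log_excess_integral_bound]).

    In a slice everything follows from one lower bound ([bumps_ge_integral]): the
    mixture at y is at least a Riemann sum for the integral of f against a normal
    kernel centred at y.
    - At almost every y with f(y) > 0 the point y is interior to the union of the
      U_m, and the Riemann sum over a small window gives liminf p_m(y) >= f(y)
      ([mixture_lower]), that is L_m(y) -> 0.
    - If the window of radius sigma_m about y lies in U_m, half of it lies in
      C(r, y, x), so p_m(y) is at least a constant times the infimum of f over
      C(r, y, x), and L_m(y) is bounded by the integrable function D = [majorant].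
    - On A_0^m, which has mass q, the last component gives
      L_m(y) <= D(y) + log (1/q).  On the part of U_m within sigma_m of an end, of
      mass t say, all of this mass is close to y, and
      L_m(y) <= D(y) + log (1/t).
    The excess over D in the last case costs only the entropies q log (1/q) and
    t log (1/t), which are bounded uniformly in x and tend to 0 because q and t
    do ([log_excess_integral_le]); the rest is dominated convergence under D. *)

(** * Disintegration of a joint law along a conditional density *)

Section measure_of_density.
Context d (T : measurableType d) (R : realType).
Variables (pi : {measure set T -> \bar R}) (w : T -> \bar R).
Hypotheses (mw : measurable_fun setT w) (w0 : forall z, (0 <= w z)%E).

Definition density_measure (E : set T) : \bar R := (\int[pi]_(z in E) w z)%E.

Let density_measure0 : density_measure set0 = 0%E.
Proof. exact: integral_set0. Qed.

Let density_measure_ge0 E : (0 <= density_measure E)%E.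
Proof. exact: integral_ge0. Qed.

Let density_measure_sigma_additive : semi_sigma_additive density_measure.
Proof.
move=> E mE tE mUE; rewrite /density_measure ge0_integral_bigcup//.
- by apply: is_cvg_ereal_nneg_natsum => n _; exact: integral_ge0.
- exact: measurable_funTS.
Qed.

HB.instance Definition _ := isMeasure.Build _ _ _ density_measure
  density_measure0 density_measure_ge0 density_measure_sigma_additive.

Definition measure_of_density : {measure set T -> \bar R} := density_measure.

End measure_of_density.

(** The density [w] is, up to a null set, the Radon-Nikodym derivative of [F]
    with respect to [pi], and the change of variables is known for the latter. *)
Lemma integral_density d (T : measurableType d) (R : realType)
    (F : {finite_measure set T -> \bar R})
    (pi : {sigma_finite_measure set T -> \bar R}) (w g : T -> \bar R) :
  measurable_fun setT w -> (forall z, (0 <= w z)%E) ->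
  (forall E, measurable E -> F E = \int[pi]_(z in E) w z)%E ->
  measurable_fun setT g -> (forall z, (0 <= g z)%E) ->
  (\int[F]_z g z = \int[pi]_z (g z * w z))%E.
Proof.
move=> mw w0 FE mg g0.
have Fpi : F `<< pi.
  apply/null_content_dominatesP => E mE piE0; rewrite FE//.
  apply/eqP; rewrite eq_le integral_ge0// andbT.
  rewrite (eq_integral (abse \o w)); last by move=> z _ /=; rewrite gee0_abs.
  by rewrite integral_abs_eq0//; exact: measurable_funTS.
have fw : ae_eq pi setT (Radon_Nikodym_SigmaFinite.f F pi) w.
  apply: integral_ae_eq => //.
    exact: Radon_Nikodym_SigmaFinite.f_integrable.
  by move=> E _ mE; rewrite -Radon_Nikodym_SigmaFinite.f_integral// FE.
rewrite -(Radon_Nikodym_SigmaFinite.change_of_variables Fpi)//.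
have mf : measurable_fun setT (Radon_Nikodym_SigmaFinite.f F pi).
  exact: measurable_int (Radon_Nikodym_SigmaFinite.f_integrable Fpi).
apply: ge0_ae_eq_integral => //.
- exact: emeasurable_funM.
- exact: emeasurable_funM.
- by move=> z _; rewrite mule_ge0// Radon_Nikodym_SigmaFinite.f_ge0.
- by move=> z _; rewrite mule_ge0.
- exact: ae_eqe_mul2l.
Qed.

(** Lebesgue measure is defined on the sigma-algebra generated by half-open
    intervals, a copy of the reals with its own measurable structure.  Product
    measures with the canonical structure need it transported along the
    identity; both structures have the same measurable sets. *)
Section lebesgue_on_reals.
Context (R : realType).

Let idR : measurableTypeR R -> R := idfun.

Let midR : measurable_fun setT idR. Proof. exact: measurable_id. Qed.

Definition lebesgueR : set R -> \bar R := pushforward lebesgue_measure idR.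

Let lebesgueR0 : lebesgueR set0 = 0%E. Proof. exact: measure0. Qed.

Let lebesgueR_ge0 A : (0 <= lebesgueR A)%E. Proof. exact: measure_ge0. Qed.

Let lebesgueR_sigma_additive : semi_sigma_additive lebesgueR.
Proof. exact: (@measure_semi_sigma_additive _ _ _ lebesgue_measure). Qed.

HB.instance Definition _ := isMeasure.Build _ _ _
  lebesgueR lebesgueR0 lebesgueR_ge0 lebesgueR_sigma_additive.

Let lebesgueR_sigma_finite : sigma_finite setT lebesgueR.
Proof. exact: (@sigma_finiteT _ _ _ lebesgue_measure). Qed.

HB.instance Definition _ := Measure_isSigmaFinite.Build _ _ _
  lebesgueR lebesgueR_sigma_finite.

Lemma ge0_integral_lebesgueR (A : set R) (g : R -> \bar R) :
  measurable A -> measurable_fun A g -> (forall y, A y -> (0 <= g y)%E) ->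
  (\int[lebesgueR]_(y in A) g y = \int[lebesgue_measure]_(y in A) g y)%E.
Proof.
move=> mA mg g0; rewrite ge0_integral_pushforward//.
by move=> y /[!inE] Ay; exact: g0.
Qed.

End lebesgue_on_reals.
Arguments lebesgueR {R}.

Section lebesgue_product.
Context d (T : measurableType d) (R : realType) (Q : probability T R).

Definition lebesgue_prod : set (R * T) -> \bar R := (@lebesgueR R \x Q)%E.

HB.instance Definition _ := Measure.on lebesgue_prod.

Let lebesgue_prod_sigma_finite : sigma_finite setT lebesgue_prod.
Proof.
have [E TE Efin] := sigma_finiteT (@lebesgueR R).
exists (fun n => E n `*` setT).
  by rewrite -setX_bigcupl -TE setXTT.
move=> n; have [mE Eoo] := Efin n; split; first exact: measurableX.
rewrite /lebesgue_prod product_measure1E//.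
apply: lte_mul_pinfty => //; first by rewrite ge0_fin_numE.
by apply: le_lt_trans (ltry 1); exact: probability_le1.
Qed.

HB.instance Definition _ := Measure_isSigmaFinite.Build _ _ _
  lebesgue_prod lebesgue_prod_sigma_finite.

End lebesgue_product.

Section disintegration.
Context d (T : measurableType d) (R : realType).
Variables (F : probability (R * T)%type R) (Q : probability T R).
Variables (Y : set R) (X : set T) (f : R -> T -> R).
Hypotheses (mY : measurable Y) (mX : measurable X).
Hypothesis FYX : F (Y `*` X) = 1%E.
Hypothesis f_ge0 : forall y x, X x -> 0 <= f y x.
Hypothesis f_off : forall y x, X x -> ~ Y y -> f y x = 0.
Hypothesis mf : measurable_fun (setT `*` X) (fun z => f z.1 z.2).
Hypothesis FE : forall A B, measurable A -> measurable B -> B `<=` X ->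
  F (A `*` B) = (\int[Q]_(x in B) \int[lebesgue_measure]_(y in A) (f y x)%:E)%E.

Let w : R * T -> \bar R := (fun z => (f z.1 z.2)%:E) \_ (setT `*` X).

Let mTX : measurable ([set: R] `*` X). Proof. exact: measurableX. Qed.

Let mw : measurable_fun setT w.
Proof. by apply/(measurable_restrictT _ mTX)/measurable_EFinP. Qed.

Let wE y x : X x -> w (y, x) = (f y x)%:E.
Proof. by move=> Xx; rewrite /w patchE mem_set. Qed.

Let mfx x : X x -> measurable_fun setT (fun y => (f y x)%:E).
Proof.
move=> Xx; rewrite (_ : (fun y => _) = w \o pair^~ x).
  by apply: measurableT_comp => //; exact: pair2_measurable.
by apply/funext => y; rewrite /= wE.
Qed.

Let w0 z : (0 <= w z)%E.
Proof.
by rewrite /w patchE; case: ifPn => // /set_mem[_ Xz]; rewrite lee_fin f_ge0.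
Qed.

Let FTX : F (~` (setT `*` X)) = 0%E.
Proof.
apply/eqP; rewrite eq_le measure_ge0 andbT.
have <- : F (~` (Y `*` X)) = 0%E.
  by rewrite probability_setC ?FYX ?subee//; exact: measurableX.
apply: le_measure; rewrite ?inE; first exact: measurableC.
  by apply: measurableC; exact: measurableX.
by apply: subsetC => z [_ Xz2].
Qed.

(* F and the measure of density w agree on the pi-system of rectangles. *)
Let F_density E : measurable E ->
  F E = (\int[lebesgue_prod Q]_(z in E) w z)%E.
Proof.
move=> mE; rewrite -[RHS]/(measure_of_density (lebesgue_prod Q) mw w0 E).
apply: (@measure_unique _ R (R * T)%type
  [set C | exists A, measurable A /\ exists B, measurable B /\ C = A `*` B]
  (fun=> setT) _ _ _ _ F (measure_of_density (lebesgue_prod Q) mw w0)) => //.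
- rewrite measurable_prod_measurableType //; congr (<<s _ >>).
  rewrite predeqE; split => [[A mA [B mB <-]]|[A [mA [B [mB ->]]]]].
    by exists A; split => //; exists B.
  by exists A => //; exists B.
- move=> /= _ _ [X1 [mX1 [X2 [mX2 ->]]]] [Y1 [mY1 [Y2 [mY2 ->]]]].
  rewrite -setXI; exists (X1 `&` Y1); split; first exact: measurableI.
  by exists (X2 `&` Y2); split => //; exact: measurableI.
- by move=> _; exists setT; split => //; exists setT; split; rewrite ?setXTT.
- by rewrite bigcup_const.
- move=> /= _ [A [mA [B [mB ->]]]].
  have mAB : measurable (A `*` B) by exact: measurableX.
  have mAX : measurable (A `*` (B `&` X)).
    by apply: measurableX => //; exact: measurableI.
  transitivity (F (A `*` (B `&` X))).
    apply/eqP; rewrite eq_le; apply/andP; split; last first.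
      apply: le_measure; rewrite ?inE//.
      by move=> z [Az [Bz _]].
    have mC : measurable (~` ([set: R] `*` X)) by exact: measurableC.
    rewrite -[leRHS]adde0 -FTX; apply: le_trans (measureU2 _ mAX mC).
    apply: le_measure; rewrite ?inE//.
      exact: measurableU.
    move=> [y x] [/= Ay Bx]; have [Xx|nXx] := pselect (X x); [by left|right].
    by move=> -[].
  have BX : B `&` X `<=` X by move=> x [].
  transitivity (\int[Q]_(x in B `&` X) \int[lebesgue_measure]_(y in A)
      (f y x)%:E)%E.
    by apply: FE => //; exact: measurableI.
  transitivity (\int[Q]_x fubini_G (@lebesgueR R) (w \_ (A `*` B)) x)%E; last first.
    rewrite -[RHS]/(\int[lebesgue_prod Q]_(z in A `*` B) w z)%E.
    rewrite [RHS]integral_mkcond [RHS]fubini_tonelli2//.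
      by apply/(measurable_restrictT _ mAB)/measurable_funTS.
    by move=> z; rewrite patchE; case: ifPn.
  rewrite integral_mkcond; apply: eq_integral => x _.
  rewrite /fubini_G patchE; case: ifPn => [/set_mem[Bx Xx]|nx].
    rewrite -ge0_integral_lebesgueR//; last 2 first.
      exact: (measurable_funTS (mfx Xx)).
      by move=> y _; rewrite lee_fin f_ge0.
    rewrite [LHS]integral_mkcond; apply: eq_integral => y _.
    rewrite !patchE; case: ifPn => [/set_mem Ay|nAy].
      by rewrite mem_set// wE.
    by rewrite memNset// => -[/= Ay _]; move/negP: nAy; rewrite inE.
  apply/esym/integral0_eq => y _; rewrite patchE; case: ifPn => // /set_mem[_ /= Bx].
  rewrite /w patchE memNset// => -[_ /= Xx].
  by move/negP: nx; apply; rewrite inE.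
- by move=> _; apply: le_lt_trans (ltry 1); exact: probability_le1.
Qed.

Let inner (g : R * T -> \bar R) x :=
  (\int[lebesgue_measure]_(y in Y) (g (y, x) * (f y x)%:E))%E.

(** Integration against the joint law [F] is integration in [y] against the
    conditional density, then in [x] against the marginal law: [F] has density
    [f] with respect to the product of Lebesgue measure and the marginal, so
    this is Tonelli's theorem. *)
Lemma disintegration (g : R * T -> \bar R) :
  measurable_fun (Y `*` X) g -> (forall z, (Y `*` X) z -> (0 <= g z)%E) ->
  measurable_fun X (fun x =>
    \int[lebesgue_measure]_(y in Y) (g (y, x) * (f y x)%:E))%E /\
  (\int[F]_(z in Y `*` X) g z =
   \int[Q]_(x in X) \int[lebesgue_measure]_(y in Y) (g (y, x) * (f y x)%:E))%E.
Proof.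
move=> mg g0.
have mYX : measurable (Y `*` X) by exact: measurableX.
pose g' := g \_ (Y `*` X).
have mg' : measurable_fun setT g' by exact/(measurable_restrictT _ mYX).
have g'0 z : (0 <= g' z)%E.
  by rewrite /g' patchE; case: ifPn => // /set_mem; exact: g0.
have mgw : measurable_fun setT (fun z => g' z * w z)%E by exact: emeasurable_funM.
have gw0 z : (0 <= g' z * w z)%E by exact: mule_ge0.
have GE : fubini_G (@lebesgueR R) (fun z => g' z * w z)%E = inner g \_ X.
  apply/funext => x; rewrite /fubini_G patchE; case: ifPn => [/set_mem Xx|nx].
    have mgx : measurable_fun setT (fun y => g' (y, x) * w (y, x))%E.
      exact: (measurableT_comp mgw (pair2_measurable x)).
    rewrite /inner -ge0_integral_lebesgueR//; last 2 first.
      apply: eq_measurable_fun (measurable_funTS mgx) => y /set_mem Yy.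
      by rewrite wE// /g' patchE mem_set.
      by move=> y Yy; rewrite mule_ge0 ?lee_fin ?f_ge0// g0.
    rewrite [RHS]integral_mkcond; apply: eq_integral => y _.
    rewrite wE// /g' !patchE; case: (ifPn (y \in Y)) => [/set_mem Yy|/negP nYy].
      by rewrite mem_set.
    rewrite memNset ?mul0e// => -[/= Yy _].
    by apply: nYy; rewrite inE.
  apply: integral0_eq => y _.
  rewrite /g' patchE memNset ?mul0e// => -[_ /= Xx].
  by move/negP: nx; rewrite inE.
split.
  apply/(measurable_restrictT _ mX); rewrite -GE.
  exact: measurable_fun_fubini_tonelli_G.
rewrite [LHS]integral_mkcond.
rewrite (@integral_density _ _ _ F (lebesgue_prod Q) _ _ mw w0 F_density mg' g'0).
by rewrite [LHS]fubini_tonelli2// GE [RHS]integral_mkcond.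
Qed.

(** An [F]-null set has null slices, except on the set where the density
    vanishes: integrate the indicator of the null set. *)
Lemma ae_slice (P : R * T -> Prop) : {ae F, forall z, P z} ->
  {ae Q, forall x, X x ->
    {ae lebesgue_measure, forall y : R, 0 < f y x -> P (y, x)}}.
Proof.
move=> [N [mN FN0 PN]].
have mYX : measurable (Y `*` X) by exact: measurableX.
pose g (z : R * T) : \bar R := (\1_N z)%:E.
have mg : measurable_fun (Y `*` X) g.
  by apply: measurable_funTS; apply/measurable_EFinP; exact: measurable_indic.
have g0 z : (0 <= g z)%E by rewrite lee_fin.
have [minner innerE] := disintegration mg (fun z _ => g0 z).
have gf0 y x : X x -> (0 <= g (y, x) * (f y x)%:E)%E.
  by move=> Xx; rewrite mule_ge0// lee_fin f_ge0.
have : ae_eq Q X (inner g) (cst 0%E).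
  have [+ _] := ae_eq_integral_abs Q mX minner; apply.
  transitivity (\int[Q]_(x in X) inner g x)%E.
    apply: eq_integral => x /[!inE] Xx; rewrite gee0_abs//.
    by apply: integral_ge0 => y _; exact: gf0.
  rewrite -innerE integral_indic//.
  apply/eqP; rewrite eq_le measure_ge0 andbT -FN0.
  by apply: le_measure; rewrite ?inE//; exact: measurableI.
apply: filterS => x innerx Xx.
have mgfx : measurable_fun Y (fun y => g (y, x) * (f y x)%:E)%E.
  apply: emeasurable_funM; last exact: (measurable_funTS (mfx Xx)).
  apply: measurable_funTS; apply/measurable_EFinP.
  have mi : measurable_fun setT (\1_N : R * T -> R) by exact: measurable_indic.
  exact: (measurableT_comp mi (pair2_measurable x)).
have : ae_eq lebesgue_measure Y (fun y => g (y, x) * (f y x)%:E)%E (cst 0%E).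
  have [+ _] := ae_eq_integral_abs lebesgue_measure mY mgfx; apply.
  rewrite -[RHS](innerx Xx); apply: eq_integral => y _.
  by rewrite gee0_abs// gf0.
have FF : Filter (almost_everywhere (@lebesgue_measure R)).
  exact: ae_filter_ringOfSetsType.
apply: filterS => y gfy fy0.
have Yy : Y y by apply: contrapT => /(f_off Xx) fy; rewrite fy ltxx in fy0.
have := gfy Yy => /= /eqP; rewrite mule_eq0 orbC [X in X || _]eqe gt_eqF//= eqe.
rewrite indicE pnatr_eq0 eqb0 notin_setE => nN.
by apply: contrapT => nP; apply: nN; exact: PN.
Qed.

End disintegration.

(** * Normal densities *)

Section normal_densities.
Context (R : realType).
Implicit Types a s h m y z : R.

Lemma normal_pdf_posE m s y : 0 < s ->
  normal_pdf m s y = normal_peak s * expR (- (y - m) ^+ 2 / (s ^+ 2 *+ 2)).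
Proof. by move=> s0; rewrite normal_pdfE ?gt_eqF. Qed.

Lemma normal_pdf_gt0 m s y : 0 < s -> 0 < normal_pdf m s y.
Proof.
by move=> s0; rewrite normal_pdf_posE// mulr_gt0 ?expR_gt0// normal_peak_gt0// gt_eqF.
Qed.

Lemma normal_peakM a s : 0 < a -> normal_peak (a * s) = normal_peak s / a.
Proof.
move=> a0; rewrite /normal_peak exprMn -mulrA -mulrnAr sqrtrM ?sqr_ge0//.
by rewrite sqrtr_sqr gtr0_norm// invfM mulrC.
Qed.

(** On this window the density is smallest at distance [2 * s] from the mean,
    where scaling reduces it to the standard normal density at 2. *)
Lemma normal_pdf_near m s y : 0 < s -> `|y - m| <= 2 * s ->
  normal_pdf 0 1 2 / s <= normal_pdf m s y.
Proof.
move=> s0 yms; rewrite !normal_pdf_posE// -[in normal_peak s](mulr1 s).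
rewrite normal_peakM// mulrAC ler_pM2l ?divr_gt0 ?normal_peak_gt0//.
rewrite ler_expR !mulNr lerN2 ler_pdivrMr ?mulrn_wgt0 ?exprn_gt0//.
rewrite subr0 expr1n -[leLHS]real_normK ?num_real//.
have -> : 2 ^+ 2 / (1 *+ 2) * (s ^+ 2 *+ 2) = (2 * s) ^+ 2 :> R by field.
by rewrite ler_sqr ?nnegrE// mulr_ge0// ltW.
Qed.

(** Moving the mean by at most [h], small compared with [s], costs only a factor
    near 1 if the standard deviation is shrunk by the factor [a].  The exponents
    are compared by the convexity inequality
    (u + v)^2 <= u^2 / a + v^2 / (1 - a). *)
Lemma normal_pdf_recentre a s h m y z : 0 < a < 1 -> 0 < s -> `|z - m| <= h ->
  a * expR (- ((h / s) ^+ 2 / (2 * (1 - a)))) * normal_pdf y (a * s) z <=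
  normal_pdf m s y.
Proof.
move=> /andP[a0 a1] s0 zmh; rewrite !normal_pdf_posE ?mulr_gt0// normal_peakM//.
have a10 : 0 < 1 - a by rewrite subr_gt0.
have [s_neq0 a_neq0 a1_neq0] : [/\ s != 0, a != 0 & 1 - a != 0].
  by rewrite !gt_eqF.
set E := expR _; set E' := expR _.
have -> : a * E * (normal_peak s / a * E') = normal_peak s * (E * E') by field.
rewrite ler_pM2l ?normal_peak_gt0// -expRD ler_expR.
have h0 : 0 <= h by exact: le_trans zmh.
have : (y - m) ^+ 2 <= (y - z) ^+ 2 / a ^+ 2 + h ^+ 2 / (1 - a).
  have zm2 : (z - m) ^+ 2 <= h ^+ 2.
    by rewrite -[leLHS]real_normK ?num_real// ler_sqr ?nnegrE.
  have : (y - m) ^+ 2 <= (y - z) ^+ 2 / a + (z - m) ^+ 2 / (1 - a).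
    rewrite -subr_ge0.
    rewrite (_ : _ - _ = ((1 - a) * (y - z) - a * (z - m)) ^+ 2 / (a * (1 - a))).
      by rewrite divr_ge0 ?sqr_ge0// mulr_ge0 ?ltW.
    by field; rewrite ?a_neq0 ?a1_neq0.
  move=> /le_trans; apply; apply: lerD.
    rewrite ler_wpM2l ?sqr_ge0// lef_pV2 ?posrE ?exprn_gt0//.
    by rewrite expr2 ler_piMr// ltW.
  by rewrite ler_wpM2r// invr_ge0 ltW.
move=> yzm; rewrite -subr_ge0.
rewrite (_ : _ - _ =
  ((y - z) ^+ 2 / a ^+ 2 + h ^+ 2 / (1 - a) - (y - m) ^+ 2) / (s ^+ 2 *+ 2)).
  by rewrite divr_ge0 ?subr_ge0// mulrn_wge0// sqr_ge0.
by field; rewrite ?a_neq0 ?a1_neq0 ?s_neq0.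
Qed.

(** A normal law gives little mass to the complement of a window much wider than
    its standard deviation.  Outside the window its density is at most a small
    multiple of the density with twice the standard deviation, whose total
    mass is 1. *)
Lemma normal_window (s eta y : R) : 0 < s -> 0 < eta ->
  ((1 - 6 * (s / eta) ^+ 2)%:E <=
   \int[lebesgue_measure]_(z in `[(y - eta)%R, (y + eta)%R])
     (normal_pdf y s z)%:E)%E.
Proof.
move=> s0 eta0; set I := `[_, _]%classic.
have mI : measurable (I : set R) by exact: measurable_itv.
have mpdf S s' : measurable_fun S (fun z : R => (normal_pdf y s' z)%:E).
  by apply: measurable_funTS; apply/measurable_EFinP; exact: measurable_normal_pdf.
have pdf0 S s' z : S z -> (0 <= (normal_pdf y s' z)%:E)%E.
  by rewrite lee_fin normal_pdf_ge0.
pose k := 2 * expR (- (3 * (eta / s) ^+ 2 / 8)).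
have k0 : 0 <= k by rewrite mulr_ge0// expR_ge0.
have mkpdf S : measurable_fun S
    (fun z : R => k%:E * (normal_pdf y (2 * s) z)%:E)%E.
  by apply: measurable_funeM; exact: mpdf.
have outside : (\int[lebesgue_measure]_(z in ~` I) (normal_pdf y s z)%:E <= k%:E)%E.
  apply: (@le_trans _ _ (\int[lebesgue_measure]_(z in ~` I)
      (k%:E * (normal_pdf y (2 * s) z)%:E)))%E.
    apply: ge0_le_integral => //.
    - exact: measurableC.
    - by move=> z; exact: pdf0.
    - exact: mpdf.
    - exact: mkpdf.
    - move=> z /= zI; rewrite lee_fin !normal_pdf_posE ?mulr_gt0//.
      rewrite normal_peakM// /k.
      rewrite [leRHS](_ : _ = normal_peak s *
          (expR (- (3 * (eta / s) ^+ 2 / 8)) *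
           expR (- (z - y) ^+ 2 / ((2 * s) ^+ 2 *+ 2)))); last by field.
      rewrite ler_pM2l ?normal_peak_gt0 ?gt_eqF// -expRD ler_expR.
      have : eta ^+ 2 <= (z - y) ^+ 2.
        rewrite -[leRHS]real_normK ?num_real// ler_sqr ?nnegrE ?(ltW eta0)//.
        rewrite leNgt; apply/negP => zy; apply: zI.
        by rewrite /I /= in_itv/= -ler_distl ltW.
      move=> ez; rewrite -subr_ge0.
      rewrite (_ : _ - _ = 3 / 8 * ((z - y) ^+ 2 - eta ^+ 2) / s ^+ 2).
        by rewrite divr_ge0 ?sqr_ge0// mulr_ge0// subr_ge0.
      by field; rewrite gt_eqF.
  apply: (@le_trans _ _ (\int[lebesgue_measure]_z
      (k%:E * (normal_pdf y (2 * s) z)%:E)))%E.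
    apply: ge0_subset_integral => //; first exact: measurableC.
      exact: mkpdf.
    by move=> z _; rewrite mule_ge0// ?lee_fin// normal_pdf_ge0.
  rewrite ge0_integralZl//; first by rewrite integral_normal_pdf mule1.
    exact: mpdf.
  by move=> z _; rewrite lee_fin normal_pdf_ge0.
have total : (\int[lebesgue_measure]_(z in I) (normal_pdf y s z)%:E +
    \int[lebesgue_measure]_(z in ~` I) (normal_pdf y s z)%:E = 1)%E.
  rewrite -ge0_integral_setU//; first by rewrite setUv integral_normal_pdf.
  - exact: measurableC.
  - exact: mpdf.
  - by move=> z; exact: pdf0.
  - by apply/disj_setPS => z [].
rewrite EFinB leeBlDr//.
rewrite -total leeD2l//; apply: le_trans outside _.
rewrite lee_fin /k.
have e0 : 0 < (eta / s) ^+ 2 by rewrite exprn_gt0// divr_gt0.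
rewrite expRN -ler_pdivlMl// -[leRHS]invrK lef_pV2 ?posrE ?expR_gt0//; last first.
  by rewrite invr_gt0 mulr_gt0// ?mulr_gt0 ?exprn_gt0 ?divr_gt0// invr_gt0.
apply: le_trans (expR_ge1Dx _); rewrite -subr_ge0.
rewrite (_ : _ - _ = 1 + (3 / 8 - 1 / 3) * (eta / s) ^+ 2); last first.
  by field; rewrite !gt_eqF.
by rewrite addr_ge0// mulr_ge0 ?sqr_ge0//; lra.
Qed.

End normal_densities.

(** * Entropy terms and windows *)

Section neglog.
Context (R : realType).

(** Minus the logarithm of [t], extended by the value [+oo] at 0 so that bounds
    by [neglog t] hold without a case distinction on [t]. *)
Definition neglog (t : R) : \bar R := lne (t%:E^-1)%E.

Lemma neglog0 : neglog 0 = +oo%E.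
Proof. by rewrite /neglog inve0. Qed.

Lemma neglog_gt0 t : 0 < t -> neglog t = (- ln t)%:E.
Proof.
by move=> t0; rewrite /neglog inver gt_eqF// lne_EFin ?invr_gt0// lnV ?posrE.
Qed.

Lemma neglog_ge0 t : 0 <= t <= 1 -> (0 <= neglog t)%E.
Proof.
move=> /andP[]; rewrite le_eqVlt => /predU1P[<- _|t0 t1].
  by rewrite neglog0 leey.
by rewrite neglog_gt0// lee_fin oppr_ge0 ln_le0.
Qed.

(** The entropy term t log (1/t) is bounded on [0, 1] and vanishes with [t]: put
    [v = sqrt t] in log (1/v) <= 1/v. *)
Lemma neglogM_le t : 0 <= t <= 1 ->
  (neglog t * t%:E <= (2 * Num.sqrt t)%:E)%E.
Proof.
move=> /andP[]; rewrite le_eqVlt => /predU1P[<- _|t0 t1].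
  by rewrite mule0 lee_fin mulr_ge0.
rewrite neglog_gt0// -EFinM lee_fin.
set v := Num.sqrt t; have v0 : 0 < v by rewrite sqrtr_gt0.
have -> : t = v ^+ 2 by rewrite sqr_sqrtr// ltW.
rewrite lnXn//.
have : - ln v <= v^-1.
  rewrite -lnV ?posrE//; apply: ltW.
  by have := ln_sublinear (x := v^-1); rewrite invr_gt0; apply.
move=> lnv.
rewrite [leLHS](_ : _ = 2 * v * (- ln v * v)); last first.
  by rewrite -mulr_natl; ring.
rewrite -[leRHS]mulr1 ler_wpM2l ?mulr_ge0 ?(ltW v0)//.
by rewrite -ler_pdivlMr// mul1r.
Qed.

Lemma lne_div_le (a w b : R) : 0 < a -> 0 < w -> w <= b ->
  (lne (a%:E / b%:E) <= (ln (a / w))%:E)%E.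
Proof.
move=> a0 w0 wb; have b0 := lt_le_trans w0 wb.
rewrite inver gt_eqF// -EFinM lne_EFin ?divr_gt0// lee_fin ler_ln ?posrE ?divr_gt0//.
by rewrite ler_pM2l// lef_pV2.
Qed.

End neglog.

Section intervals.
Context (R : realType).
Local Notation lam := (@lebesgue_measure R).
Implicit Types (I : set R) (a b y : R).

Lemma itv_sub_interval I a b : is_interval I -> I a -> I b ->
  `[a, b]%classic `<=` I.
Proof.
by move=> II Ia Ib z /=; rewrite in_itv/= => zab; exact: (II a b).
Qed.

Lemma interval_dist_le I a b (h : R) : is_interval I -> I a -> I b ->
  (lam I <= h%:E)%E -> `|a - b| <= h.
Proof.
move=> II; wlog ab : a b / a <= b.
  move=> wl Ia Ib Ih; have [ab|/ltW ba] := leP a b; first exact: wl.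
  by rewrite distrC; exact: wl.
move=> Ia Ib Ih; rewrite distrC ger0_norm ?subr_ge0//.
rewrite -lee_fin; apply: le_trans Ih.
have <- : lam `[a, b]%classic = (b - a)%:E.
  rewrite lebesgue_measure_itv/= lte_fin; move: ab.
  by rewrite le_eqVlt => /predU1P[->|ab]; rewrite ?ltxx ?subrr// ab EFinB.
apply: le_measure; rewrite ?inE.
- exact: measurable_itv.
- exact: is_interval_measurable.
- exact: itv_sub_interval.
Qed.

(** An interval that contains [y] and is long enough either lies in the window
    of radius [s] about [y], or leaves it and so covers the half of the window
    on that side. *)
Lemma interval_window I y (s r : R) : is_interval I -> I y -> lam I = r%:E ->
  0 < s -> 2 * s <= r -> (s%:E <= lam (I `&` `[(y - s)%R, (y + s)%R]))%E.
Proof.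
move=> II Iy Ir s0 sr.
have mI : measurable I by exact: is_interval_measurable.
have mW : measurable (`[(y - s)%R, (y + s)%R]%classic : set R).
  exact: measurable_itv.
have mIW : measurable (I `&` `[(y - s)%R, (y + s)%R]) by exact: measurableI.
have itvs a b : a < b -> (b - a) = s -> I a -> I b -> y - s <= a -> b <= y + s ->
    (s%:E <= lam (I `&` `[(y - s)%R, (y + s)%R]))%E.
  move=> ab bas Ia Ib ya yb.
  have <- : lam `[a, b]%classic = s%:E.
    by rewrite lebesgue_measure_itv/= lte_fin ab -EFinB bas.
  apply: le_measure; rewrite ?inE//.
  move=> z zab; split; first exact: (itv_sub_interval II Ia Ib zab).
  by move: zab => /=; rewrite !in_itv/= => /andP[za zb]; apply/andP; split; lra.
have [IW|/existsNP[z /not_implyP[Iz /negP zW]]] :=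
    pselect (forall z, I z -> z \in `[(y - s)%R, (y + s)%R]).
  rewrite (_ : _ `&` _ = I) ?Ir ?lee_fin; first by lra.
  by apply/seteqP; split => [z []//|z Iz]; split => //=; exact: IW.
move: zW; rewrite in_itv/= negb_and -!ltNge => /orP[zy|yz].
  apply: (@itvs (y - s) y) => //; [lra|lra| |lra].
  by apply: (II z y) => //; rewrite ltW//=; lra.
apply: (@itvs y (y + s)) => //; [lra|lra| |lra].
by apply: (II y z) => //; rewrite (ltW yz) andbT; lra.
Qed.

End intervals.

(** * Lower bounds for mixtures over a partition *)

(** The conditional probability of [S] in a slice with conditional density [f]. *)
Definition mass (R : realType) (f : R -> R) (S : set R) : \bar R :=
  (\int[lebesgue_measure]_(y in S) (f y)%:E)%E.

Definition cells_union (R : realType) (A : nat -> set R) (m : nat) : set R :=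
  \bigcup_(j in [set j | (0 < j <= m)%N]) A j.

Definition bumps (R : realType) (mu : nat -> R) (s p : R) (m : nat) (y : R) : R :=
  \sum_(1 <= j < m.+1) p * normal_pdf (mu j) s y.

Section bumps.
Context (R : realType).
Variables (f : R -> R) (A : nat -> set R) (mu : nat -> R) (m : nat) (s h p : R).
Hypotheses (mf : measurable_fun setT f) (f0 : forall y, 0 <= f y).
Hypothesis Aitv : forall j, (0 < j <= m)%N -> is_interval (A j).
Hypothesis Adisj : trivIset [set j | (j <= m)%N] A.
Hypothesis muA : forall j, (0 < j <= m)%N -> A j (mu j).
Hypothesis Ah : forall j, (0 < j <= m)%N -> (lebesgue_measure (A j) <= h%:E)%E.
Hypothesis Ap : forall j, (0 < j <= m)%N -> mass f (A j) = p%:E.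
Hypothesis s0 : 0 < s.

Lemma bumps_ge0 y : 0 <= p -> 0 <= bumps mu s p m y.
Proof. by move=> p0; apply: sumr_ge0 => j _; rewrite mulr_ge0// normal_pdf_ge0. Qed.

Lemma cell_mu_dist j z : (0 < j <= m)%N -> A j z -> `|z - mu j| <= h.
Proof.
move=> jm Az; apply: (interval_dist_le (Aitv jm)) => //; first exact: muA.
exact: Ah.
Qed.

(** The mixture is bounded below by a Riemann sum: each cell contributes the
    integral of the density over the cell times the normal density centred in
    the cell, and the latter may be replaced by any smaller [psi]. *)
Lemma bumps_ge_integral (S : set R) (psi : R -> R) y :
  measurable S -> S `<=` cells_union A m ->
  measurable_fun setT psi -> (forall z, 0 <= psi z) ->
  (forall j z, (0 < j <= m)%N -> A j z -> S z -> psi z <= normal_pdf (mu j) s y) ->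
  (\int[lebesgue_measure]_(z in S) (f z * psi z)%:E <= (bumps mu s p m y)%:E)%E.
Proof.
move=> mS SU mpsi psi0 psi_le.
have mA j : (0 < j <= m)%N -> measurable (A j).
  by move=> jm; apply: is_interval_measurable; exact: Aitv.
have inm j : j \in index_iota 1 m.+1 -> (0 < j <= m)%N by rewrite mem_index_iota.
pose G j := if (0 < j <= m)%N then A j `&` S else set0.
have mG j : measurable (G j).
  by rewrite /G; case: ifPn => // jm; apply: measurableI => //; exact: mA.
have mfpsi D : measurable_fun D (fun z => (f z * psi z)%:E).
  by apply: measurable_funTS; apply/measurable_EFinP; exact: measurable_funM.
have SG : S = \big[setU/set0]_(j <- index_iota 1 m.+1) G j.
  rewrite -bigcup_seq; apply/seteqP; split => [z Sz|z [j /= /inm jm]].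
    have [j jm Az] := SU z Sz; exists j => /=; first by rewrite mem_index_iota.
    by rewrite /G ifT.
  by rewrite /G jm => -[].
rewrite [X in (\int[_]_(_ in X) _)%E]SG ge0_integral_bigsetU//; last 4 first.
- exact: iota_uniq.
- apply/trivIsetP => i j /= /inm im /inm jm ij; rewrite /G im jm.
  rewrite setIACA (_ : A i `&` A j = set0) ?set0I//.
  move/trivIsetP : Adisj; apply => //=.
    by case/andP: im.
  by case/andP: jm.
- exact: mfpsi.
- by move=> z _; rewrite lee_fin mulr_ge0.
rewrite /bumps -sumEFin big_seq [leRHS]big_seq; apply: lee_sum => j /inm jm.
rewrite EFinM -(Ap jm) /mass muleC -ge0_integralZl//; last 3 first.
- by apply: measurable_funTS; exact/measurable_EFinP.
- by move=> z _; rewrite lee_fin.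
- by rewrite lee_fin normal_pdf_ge0.
rewrite /G jm; apply: (@le_trans _ _ (\int[lebesgue_measure]_(z in A j `&` S)
    ((normal_pdf (mu j) s y)%:E * (f z)%:E))%E).
  apply: ge0_le_integral => //.
  - by apply: measurableI => //; exact: mA.
  - by move=> z _; rewrite lee_fin mulr_ge0.
  - exact: mfpsi.
  - by apply: measurable_funeM; apply: measurable_funTS; exact/measurable_EFinP.
  - move=> z [Az Sz]; rewrite -EFinM lee_fin mulrC ler_wpM2r//.
    exact: psi_le.
apply: ge0_subset_integral => //.
- by apply: measurableI => //; exact: mA.
- exact: mA.
- by apply: measurable_funeM; apply: measurable_funTS; exact/measurable_EFinP.
- by move=> z _; rewrite mule_ge0 ?lee_fin ?normal_pdf_ge0.
exact: mA.
Qed.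

(** Every cell that meets a set within [s] of [y] has its centre within [2 s] of
    [y], so the mixture at [y] is at least of the order of the mass of the set
    divided by [s]. *)
Lemma bumps_ge_mass (S : set R) y : measurable S -> S `<=` cells_union A m ->
  h <= s -> (forall z, S z -> `|z - y| <= s) ->
  (mass f S * (normal_pdf 0 1 2 / s)%:E <= (bumps mu s p m y)%:E)%E.
Proof.
move=> mS SU hs Sy.
have c0 : 0 <= normal_pdf 0 1 2 / s :> R by rewrite divr_ge0 ?normal_pdf_ge0 ?ltW.
have := bumps_ge_integral (psi := cst (normal_pdf 0 1 2 / s)) (y := y) mS SU.
move=> /(_ (measurable_cst _)) /(_ (fun=> c0)) bnd.
rewrite /mass muleC -ge0_integralZl//; last 2 first.
- by apply: measurable_funTS; exact/measurable_EFinP.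
- by move=> z _; rewrite lee_fin.
under eq_integral do rewrite -EFinM mulrC.
apply: bnd => j z jm Az Sz; apply: normal_pdf_near => //.
rewrite (_ : y - mu j = (z - mu j) - (z - y)); last by ring.
rewrite (le_trans (ler_normB _ _))// mulr_natl mulr2n lerD//; last exact: Sy.
by rewrite (le_trans (cell_mu_dist jm Az)).
Qed.

End bumps.

(** * The log-excess at one scale *)

Section mass_lemmas.
Context (R : realType) (f : R -> R).
Hypotheses (mf : measurable_fun setT f) (f0 : forall y, 0 <= f y).

Lemma measurable_density D : measurable_fun D (fun y => (f y)%:E).
Proof. by apply: measurable_funTS; exact/measurable_EFinP. Qed.

Lemma mass_ge0 S : (0 <= mass f S)%E.
Proof. by apply: integral_ge0 => y _; rewrite lee_fin. Qed.

Lemma le_mass S S' : measurable S -> measurable S' -> S `<=` S' ->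
  (mass f S <= mass f S')%E.
Proof.
move=> mS mS' SS'; apply: ge0_subset_integral => //.
- exact: measurable_density.
- by move=> y _; rewrite lee_fin.
Qed.

Hypothesis f1 : mass f setT = 1%E.

Lemma mass_le1 S : measurable S -> (mass f S <= 1)%E.
Proof. by move=> mS; rewrite -f1; exact: le_mass. Qed.

Lemma fine_massK S : measurable S -> (fine (mass f S))%:E = mass f S.
Proof.
by move=> mS; rewrite fineK// ge0_fin_numE ?mass_ge0// (le_lt_trans (mass_le1 mS)) ?ltry.
Qed.

Lemma fine_mass_ge0_le1 S : measurable S -> 0 <= fine (mass f S) <= 1.
Proof. by move=> mS; rewrite -!lee_fin fine_massK// mass_ge0 mass_le1. Qed.

Lemma massU S S' : measurable S -> measurable S' -> [disjoint S & S'] ->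
  mass f (S `|` S') = (mass f S + mass f S')%E.
Proof.
move=> mS mS' SS'; apply: ge0_integral_setU => //.
- exact: measurable_density.
- by move=> y _; rewrite lee_fin.
Qed.

Lemma mass_setC S : measurable S -> (mass f S + mass f (~` S))%E = 1%E.
Proof.
move=> mS; rewrite -massU//; first by rewrite setUv.
  exact: measurableC.
by apply/disj_setPS => z [].
Qed.

Lemma mass_support Y : (forall y, ~ Y y -> f y = 0) -> mass f Y = 1%E.
Proof.
move=> f_off; rewrite -f1 /mass integral_mkcond; apply: eq_integral => y _.
by rewrite patchE; case: ifPn => // /negP yY; rewrite f_off// => /mem_set.
Qed.

End mass_lemmas.

(** The loss in [bumps_ge_mass], on the logarithmic scale. *)
Definition core_const (R : realType) : R := Num.max (- ln (normal_pdf 0 1 2)) 0.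

(** The majorant of the log-excess that depends on neither the partition nor the
    bandwidth.  The first term is the oscillation of log [f] over the
    neighbourhood [C y] of [y], the second minus the logarithm of the density of
    the tail component on the scale [r]. *)
Definition majorant (R : realType) (f : R -> R) (C : R -> set R) (s0 r y : R)
    : \bar R :=
  (maxe (lne ((f y)%:E / (inf [set f w | w in C y])%:E)) 0 +
   maxe (- (ln (normal_pdf 0 s0 y * r / 2))%:E) 0 + (core_const R)%:E)%E.

Definition mixture (R : realType) (mu : nat -> R) (s p q s0 : R) (m : nat) (y : R)
  : R := bumps mu s p m y + q * normal_pdf 0 s0 y.

Definition log_excess (R : realType) (f : R -> R) (g : R -> R) (y : R) : \bar R :=
  maxe (lne ((f y)%:E / (g y)%:E)) 0.

(** For an interval [V], the part of [V] within [`|e|] of its right end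
    ([0 < e]) or left end ([e < 0]). *)
Definition edge (R : realType) (V : set R) (e : R) := [set y | V y /\ ~ V (y + e)].

Lemma measurable_edge (R : realType) (V : set R) e :
  measurable V -> measurable (edge V e).
Proof.
move=> mV; have -> : edge V e = V `\` ((fun y => y + e) @^-1` V) by [].
apply: measurableD => //; rewrite -[X in measurable X]setTI.
by apply: measurable_funD => //; exact: measurable_cst.
Qed.

Lemma cell0E (R : realType) (Y : set R) (A : nat -> set R) (m : nat) :
  \bigcup_(j in [set j | (j <= m)%N]) A j = Y ->
  trivIset [set j | (j <= m)%N] A -> A 0%N = Y `\` cells_union A m.
Proof.
move=> AY Adisj; rewrite -AY; apply/seteqP; split => [y Ay|y [[j jm Aj] nU]].
  split; first by exists 0%N.
  move=> [j /andP[j0 jm] Aj]; move/trivIsetP : Adisj => /(_ 0%N j).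
  have : (A 0%N `&` A j) y by split.
  move=> /[swap] H; rewrite H//=; first by rewrite lt_eqF.
by case: j jm Aj => // j jm Aj; exfalso; apply: nU; exists j.+1.
Qed.

Section one_scale.
Context (R : realType).
Variables (f : R -> R) (Y : set R) (A : nat -> set R) (mu : nat -> R) (m : nat).
Variables (s h p q s0 r : R) (C : R -> set R).
Hypotheses (mf : measurable_fun setT f) (f0 : forall y, 0 <= f y).
Hypotheses (f1 : mass f setT = 1%E) (mY : measurable Y).
Hypothesis Aitv : forall j, (0 < j <= m)%N -> is_interval (A j).
Hypothesis Uitv : is_interval (cells_union A m).
Hypothesis AY : \bigcup_(j in [set j | (j <= m)%N]) A j = Y.
Hypothesis Adisj : trivIset [set j | (j <= m)%N] A.
Hypothesis muA : forall j, (0 < j <= m)%N -> A j (mu j).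
Hypothesis Ah : forall j, (0 < j <= m)%N -> (lebesgue_measure (A j) <= h%:E)%E.
Hypothesis Ap : forall j, (0 < j <= m)%N -> mass f (A j) = p%:E.
Hypothesis A0q : mass f (A 0%N) = q%:E.
Hypotheses (sgt0 : 0 < s) (s0gt0 : 0 < s0) (p0 : 0 <= p) (hs : h <= s) (sr : 2 * s <= r).
Hypothesis Citv : forall y, Y y -> is_interval (C y).
Hypothesis Clen : forall y, Y y -> lebesgue_measure (C y) = r%:E.
Hypothesis Cy : forall y, Y y -> C y y.

Local Notation U := (cells_union A m).
Local Notation mix := (mixture mu s p q s0 m).
Local Notation D := (majorant f C s0 r).
Local Notation L := (log_excess f mix).
Local Notation c := (normal_pdf 0 1 2 : R).
Let i y := inf [set f w | w in C y].

Local Notation Bp := (edge U s).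
Local Notation Bm := (edge U (- s)).

Let mU : measurable U. Proof. exact: is_interval_measurable. Qed.

Let mB e : measurable (edge U e). Proof. exact: measurable_edge. Qed.

Let A0E : A 0%N = Y `\` U. Proof. exact: cell0E. Qed.

Let mA0 : measurable (A 0%N). Proof. by rewrite A0E; exact: measurableD. Qed.

Let UY : U `<=` Y.
Proof. by rewrite -AY => y [j /andP[_ jm] Aj]; exists j. Qed.

Let tp := fine (mass f Bp).
Let tm := fine (mass f Bm).

(** What [majorant] may miss.  On the tail cell the mixture is only known to be
    [q] times the tail component, and near an end of the union of the cells
    only the mass of the edge itself is sure to be close by. *)
Definition edge_penalty y : \bar R :=
  (neglog q * (\1_(A 0%N) y)%:E + neglog tp * (\1_Bp y)%:E +
   neglog tm * (\1_Bm y)%:E)%E.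

Let q01 : 0 <= q <= 1.
Proof. by rewrite -!lee_fin -A0q mass_ge0// mass_le1. Qed.

Let tp01 : 0 <= tp <= 1. Proof. exact: fine_mass_ge0_le1. Qed.
Let tm01 : 0 <= tm <= 1. Proof. exact: fine_mass_ge0_le1. Qed.

Let c0 : 0 < c. Proof. exact: normal_pdf_gt0. Qed.

Let i_ge0 y : Y y -> 0 <= i y.
Proof.
move=> Yy; apply: lb_le_inf; first by exists (f y) => /=; exists y => //; exact: Cy.
by move=> _ [w _ <-].
Qed.

Let i_le y z : C y z -> i y <= f z.
Proof.
by move=> Cz; apply: ge_inf; [exists 0 => _ [w _ <-]|exists z].
Qed.

Let mC y : Y y -> measurable (C y).
Proof. by move=> Yy; apply: is_interval_measurable; exact: Citv. Qed.

Let mass_ge_inf y S : Y y -> measurable S -> S `<=` C y ->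
  ((i y)%:E * lebesgue_measure S <= mass f S)%E.
Proof.
move=> Yy mS SC; rewrite -integral_cst//; apply: ge0_le_integral => //.
- by move=> z _; rewrite lee_fin i_ge0.
- exact: measurable_density.
- by move=> z Sz; rewrite lee_fin; apply: i_le; exact: SC.
Qed.

Let i_r y : Y y -> i y * r <= 1.
Proof.
move=> Yy; rewrite -lee_fin EFinM -(Clen Yy).
apply: le_trans (mass_le1 mf f0 f1 (mC Yy)).
by apply: mass_ge_inf => //; exact: mC.
Qed.

Let mix_gt y w : 0 <= w -> (w%:E <= (bumps mu s p m y)%:E)%E -> w <= mix y.
Proof.
move=> w0; rewrite lee_fin => /le_trans; apply; rewrite lerDl mulr_ge0 ?normal_pdf_ge0//.
by case/andP : q01.
Qed.

(* An edge has diameter at most s, so all of its mass is close to each of its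
   points. *)
Let mix_ge_edge y e : (e == s) || (e == - s) -> edge U e y ->
  fine (mass f (edge U e)) * (c / s) <= mix y.
Proof.
move=> es Bey; apply: mix_gt.
  rewrite mulr_ge0 ?divr_ge0 ?(ltW c0) ?(ltW sgt0)//.
  by case/andP : (fine_mass_ge0_le1 mf f0 f1 (mB e)).
rewrite EFinM fine_massK//; apply: (bumps_ge_mass (A := A) (h := h)) => //.
  by move=> z [].
move=> z Bez; have s_gt0 := sgt0; move: Bey Bez => [Uy nUy] [Uz nUz].
rewrite leNgt; apply/negP => yz.
have [zy|yz'] := leP z y.
  move: yz; rewrite distrC ger0_norm ?subr_ge0// => yz.
  case/orP : es => /eqP es.
    by apply: nUz; rewrite es; apply: (Uitv Uz Uy); apply/andP; split; lra.
  by apply: nUy; rewrite es; apply: (Uitv Uz Uy); apply/andP; split; lra.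
move: yz; rewrite gtr0_norm ?subr_gt0// => yz.
case/orP : es => /eqP es.
  by apply: nUy; rewrite es; apply: (Uitv Uy Uz); apply/andP; split; lra.
by apply: nUz; rewrite es; apply: (Uitv Uy Uz); apply/andP; split; lra.
Qed.

(* Away from the edges the whole window of radius s lies in the union of the
   cells, and C y covers at least half of it. *)
Let mix_ge_core y : U y -> ~ Bp y -> ~ Bm y -> i y * c <= mix y.
Proof.
move=> Uy nBp nBm.
have Up : U (y + s) by apply: contrapT => nU; exact: nBp.
have Um : U (y - s) by apply: contrapT => nU; exact: nBm.
have Yy := UY Uy.
apply: mix_gt; first by rewrite mulr_ge0 ?i_ge0// ltW.
pose S := C y `&` `[(y - s)%R, (y + s)%R].
have mS : measurable S by apply: measurableI; [exact: mC|exact: measurable_itv].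
have SU : S `<=` U.
  by move=> z [_ /=]; rewrite in_itv/=; exact: (Uitv Um Up).
have Sy z : S z -> `|z - y| <= s.
  by move=> [_ /=]; rewrite in_itv/= ler_distl.
apply: le_trans (bumps_ge_mass mf f0 Aitv Adisj muA Ah Ap sgt0 mS SU hs Sy).
rewrite (_ : i y * c = (i y * s) * (c / s)); last first.
  by field; rewrite gt_eqF.
rewrite [leLHS]EFinM lee_wpmul2r ?lee_fin ?divr_ge0 ?(ltW c0) ?(ltW sgt0)//.
have SC : S `<=` C y by move=> z [].
apply: le_trans (mass_ge_inf Yy mS SC).
rewrite EFinM lee_wpmul2l ?lee_fin ?i_ge0//.
by apply: interval_window (Clen Yy) _ _ => //; [exact: Citv|exact: Cy].
Qed.

Lemma edge_penalty_ge0 y : (0 <= edge_penalty y)%E.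
Proof. by rewrite !adde_ge0// mule_ge0 ?neglog_ge0// lee_fin. Qed.

Let penalty_ge (t : R) (S : set R) y : S y ->
  (neglog t * (\1_S y)%:E)%E = neglog t.
Proof. by move=> Sy; rewrite indicE mem_set// mule1. Qed.

Let pen_ge0 (t : R) (S : set R) y : 0 <= t <= 1 ->
  (0 <= neglog t * (\1_S y)%:E)%E.
Proof. by move=> t01; rewrite mule_ge0 ?neglog_ge0// lee_fin. Qed.

Hypothesis r0 : 0 < r.

(** In each of the three regions (tail cell, edges, core) the lower bound on the
    mixture is compared with the infimum [i y] of [f] over [C y], for which
    [i y * r <= 1] since [f] has total mass 1. *)
Lemma log_excess_le y : Y y -> 0 < f y -> (L y <= D y + edge_penalty y)%E.
Proof.
move=> Yy fy0; have [s_gt0 sr2] := (sgt0, sr).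
have nNy (e : \bar R) : (0 <= e)%E -> e != -oo%E by case: e.
have K0 : 0 <= core_const R by rewrite /core_const le_max lexx orbT.
have Kge : - ln c <= core_const R by rewrite /core_const le_max lexx.
have D0 : (0 <= D y)%E.
  by rewrite /majorant !adde_ge0// ?lee_fin// le_max lexx orbT.
rewrite {1}/log_excess ge_max; apply/andP; split; last first.
  by rewrite adde_ge0// edge_penalty_ge0.
have [iy0|iy0] := eqVneq (i y) 0.
  rewrite /majorant -/(i y) iy0 inve0 gt0_muley ?lte_fin//=.
  rewrite (_ : maxe +oo 0 = +oo)%E; last by rewrite maxEge leey.
  rewrite addye; last by rewrite nNy// le_max lexx orbT.
  by rewrite addye ?leey// nNy// edge_penalty_ge0.
have {}iy0 : 0 < i y by rewrite lt_neqAle eq_sym iy0 i_ge0.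
set a := ln (f y / i y); set g := normal_pdf 0 s0 y * r / 2.
have g0 : 0 < g by rewrite /g divr_gt0// mulr_gt0// normal_pdf_gt0.
have a0 : 0 <= a.
  by rewrite ln_ge0// ler_pdivlMr// mul1r; apply: i_le; exact: Cy.
have DE : D y = (a + Num.max (- ln g) 0 + core_const R)%:E.
  rewrite /majorant -/(i y) inver gt_eqF// -EFinM lne_EFin ?divr_gt0// -/a.
  by rewrite -EFinN -!EFin_max -!EFinD (max_l a0).
have q0 : 0 <= q by case/andP: q01.
have e0 := edge_penalty_ge0 y.
(* It suffices to bound the mixture from below by some w with
   log (f / w) <= D + k, where k is one of the penalties. *)
have gen (k : R) w : w <= mix y -> 0 < w ->
    ln (f y / w) <= a + Num.max (- ln g) 0 + core_const R + k ->
    (k%:E <= edge_penalty y)%E ->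
    (lne ((f y)%:E / (mix y)%:E) <= D y + edge_penalty y)%E.
  move=> wm w0 lnk ke; apply: le_trans (lne_div_le fy0 w0 wm) _.
  by apply: (@le_trans _ _ (D y + k%:E)%E); [rewrite DE -EFinD lee_fin|rewrite leeD2l].
have maxg : - ln g <= Num.max (- ln g) 0 by rewrite le_max lexx.
have max0 : 0 <= Num.max (- ln g) 0 by rewrite le_max lexx orbT.
have [Uy|nUy] := pselect (U y); last first.
  have A0y : A 0%N y by rewrite A0E.
  move: q0; rewrite le_eqVlt => /predU1P[q_eq0|q_gt0].
    rewrite /edge_penalty -q_eq0 neglog0 indicE mem_set// mule1.
    rewrite addye ?nNy ?pen_ge0// addye ?nNy ?pen_ge0//.
    by rewrite DE addey ?leey.
  apply: (@gen (- ln q) (q * normal_pdf 0 s0 y)).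
  - by rewrite lerDr; exact: bumps_ge0.
  - by rewrite mulr_gt0// normal_pdf_gt0.
  - have -> : f y / (q * normal_pdf 0 s0 y) = (f y / i y) * g^-1 * q^-1 * (i y * r / 2).
      rewrite /g; have n0 := normal_pdf_gt0 0 y s0gt0.
      by field; rewrite !gt_eqF.
    have ir0 : 0 < i y * r / 2 by rewrite divr_gt0// mulr_gt0.
    have ir1 : ln (i y * r / 2) <= 0.
      by rewrite ln_le0// ler_pdivrMr// mul1r (le_trans (i_r Yy))// ler1n.
    rewrite lnM ?posrE ?mulr_gt0 ?divr_gt0 ?invr_gt0//.
    rewrite lnM ?posrE ?mulr_gt0 ?divr_gt0 ?invr_gt0//.
    rewrite lnM ?posrE ?mulr_gt0 ?divr_gt0 ?invr_gt0//.
    rewrite -/a (lnV (x := g)) ?posrE// (lnV (x := q)) ?posrE//.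
    by lra.
  - rewrite -neglog_gt0// /edge_penalty penalty_ge//.
    by rewrite -addeA leeDl// adde_ge0// pen_ge0.
have near_end e : (e == s) || (e == - s) -> edge U e y ->
    (neglog (fine (mass f (edge U e))) <= edge_penalty y)%E ->
    (lne ((f y)%:E / (mix y)%:E) <= D y + edge_penalty y)%E.
  move=> es Bey; have /andP[+ _] := fine_mass_ge0_le1 mf f0 f1 (mB e).
  have mixe := mix_ge_edge es Bey.
  set t := fine _ in mixe *; rewrite le_eqVlt => /predU1P[<-|t0 te].
    by rewrite neglog0 leye_eq => /eqP->; rewrite DE addey ?leey.
  apply: (gen (- ln t) _ mixe).
  - by rewrite mulr_gt0// divr_gt0.
  - have -> : f y / (t * (c / s)) = (f y / i y) * c^-1 * t^-1 * (i y * s).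
      by field; rewrite !gt_eqF.
    have is0 : 0 < i y * s by rewrite mulr_gt0.
    have is1 : ln (i y * s) <= 0.
      rewrite ln_le0// (le_trans _ (i_r Yy))// ler_wpM2l ?i_ge0//.
      by lra.
    rewrite lnM ?posrE ?mulr_gt0 ?divr_gt0 ?invr_gt0//.
    rewrite lnM ?posrE ?mulr_gt0 ?divr_gt0 ?invr_gt0//.
    rewrite lnM ?posrE ?mulr_gt0 ?divr_gt0 ?invr_gt0//.
    rewrite -/a (lnV (x := c)) ?posrE// (lnV (x := t)) ?posrE//.
    by lra.
  - by rewrite -neglog_gt0.
have [Bpy|nBp] := pselect (Bp y).
  apply: (near_end s) => //; first by rewrite eqxx.
  rewrite -/tp /edge_penalty (penalty_ge tp Bpy).
  by rewrite -addeA addeCA leeDl// adde_ge0// pen_ge0.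
have [Bmy|nBm] := pselect (Bm y).
  apply: (near_end (- s)) => //; first by rewrite eqxx orbT.
  rewrite -/tm /edge_penalty (penalty_ge tm Bmy).
  by rewrite leeDr// adde_ge0// pen_ge0.
apply: (@gen 0 (i y * c)) => //.
- exact: mix_ge_core.
- by rewrite mulr_gt0.
- have -> : f y / (i y * c) = (f y / i y) * c^-1 by field; rewrite !gt_eqF.
  rewrite lnM ?posrE ?mulr_gt0 ?divr_gt0 ?invr_gt0// -/a (lnV (x := c)) ?posrE//.
  by lra.
Qed.

(* A penalty -log t carried by a set of mass t costs the entropy t log (1/t),
   also when t = 0. *)
Let integral_neglog_indic t (S : set R) : measurable S -> S `<=` Y ->
  mass f S = t%:E ->
  measurable_fun Y (fun y => neglog t * (\1_S y)%:E * (f y)%:E)%E /\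
  (\int[lebesgue_measure]_(y in Y) (neglog t * (\1_S y)%:E * (f y)%:E)
    <= (2 * Num.sqrt t)%:E)%E.
Proof.
move=> mS SY St.
have t01 : 0 <= t <= 1 by rewrite -!lee_fin -St mass_ge0// mass_le1.
have mind : measurable_fun Y (fun y => (\1_S y)%:E * (f y)%:E)%E.
  apply: emeasurable_funM; last exact: measurable_density.
  by apply: measurable_funTS; apply/measurable_EFinP; exact: measurable_indic.
split.
  by under eq_fun do rewrite -muleA; exact: measurable_funeM.
apply: le_trans (neglogM_le t01).
under eq_integral do rewrite -muleA.
rewrite ge0_integralZl//; last 2 first.
- by move=> y _; rewrite mule_ge0// lee_fin.
- exact: neglog_ge0.
rewrite lee_wpmul2l ?neglog_ge0// -St /mass.
rewrite -(setIidr SY) [leRHS]integral_mkcondr le_eqVlt; apply/orP; left; apply/eqP.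
by apply: eq_integral => y _; rewrite (setIidr SY) epatch_indic muleC.
Qed.

(** Since L <= D + penalty, also L <= min (L, D) + penalty.  The minimum is
    dominated by an integrable function, and the integral of the penalty is
    controlled by the masses [q], [tp] and [tm] alone. *)
Lemma log_excess_integral_le : measurable_fun Y L -> measurable_fun Y D ->
  (\int[lebesgue_measure]_(y in Y) (L y * (f y)%:E) <=
   \int[lebesgue_measure]_(y in Y) (mine (L y) (D y) * (f y)%:E) +
   (2 * Num.sqrt q + 2 * Num.sqrt tp + 2 * Num.sqrt tm)%:E)%E.
Proof.
move=> mL mD.
have L0 y : (0 <= L y)%E by rewrite le_max lexx orbT.
have D0 y : (0 <= D y)%E.
  rewrite /majorant !adde_ge0// ?lee_fin// ?le_max ?lexx ?orbT//.
have min0 y : (0 <= mine (L y) (D y))%E by rewrite le_min L0 D0.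
have A0Y : A 0%N `<=` Y by rewrite A0E => y [].
have BY e : edge U e `<=` Y by move=> y [/UY].
have [mq intq] := integral_neglog_indic mA0 A0Y A0q.
have [mtp inttp] := integral_neglog_indic (mB s) (BY s)
  (esym (fine_massK mf f0 f1 (mB s))).
have [mtm inttm] := integral_neglog_indic (mB (- s)) (BY (- s))
  (esym (fine_massK mf f0 f1 (mB (- s)))).
have fE0 y : (0 <= (f y)%:E)%E by rewrite lee_fin.
have mmin : measurable_fun Y (fun y => mine (L y) (D y) * (f y)%:E)%E.
  by apply: emeasurable_funM; [exact: measurable_mine|exact: measurable_density].
pose Q y := (neglog q * (\1_(A 0%N) y)%:E * (f y)%:E)%E.
pose P1 y := (neglog tp * (\1_Bp y)%:E * (f y)%:E)%E.
pose P2 y := (neglog tm * (\1_Bm y)%:E * (f y)%:E)%E.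
have Q0 y : (0 <= Q y)%E by rewrite mule_ge0// pen_ge0.
have P10 y : (0 <= P1 y)%E by rewrite mule_ge0// pen_ge0.
have P20 y : (0 <= P2 y)%E by rewrite mule_ge0// pen_ge0.
apply: (@le_trans _ _ (\int[lebesgue_measure]_(y in Y)
   (mine (L y) (D y) * (f y)%:E + (Q y + P1 y + P2 y)))%E).
  apply: ge0_le_integral => //.
  - by move=> y _; rewrite mule_ge0.
  - by apply: emeasurable_funM => //; exact: measurable_density.
  - by apply: emeasurable_funD => //; do 2 apply: emeasurable_funD => //.
  - move=> y Yy; rewrite /Q /P1 /P2 -!ge0_muleDl ?adde_ge0 ?pen_ge0//.
    move: (f0 y); rewrite le_eqVlt => /predU1P[<-|fy0]; first by rewrite !mule0.
    rewrite lee_wpmul2r//.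
    have := log_excess_le Yy fy0; rewrite /edge_penalty.
    rewrite minEle; case: ifPn => // _ _.
    by rewrite leeDl// !adde_ge0// pen_ge0.
rewrite ge0_integralD//; last 3 first.
- by move=> y _; rewrite mule_ge0.
- by move=> y _; rewrite !adde_ge0.
- by do 2 apply: emeasurable_funD => //.
rewrite leeD2l// ge0_integralD//; last 2 first.
- by move=> y _; rewrite adde_ge0.
- exact: emeasurable_funD.
rewrite ge0_integralD// !EFinD; apply: leeD => //; exact: leeD.
Qed.

(** The same bound with constants that are uniform in the slice: the three
    masses are at most 1. *)
Lemma log_excess_integral_bound : measurable_fun Y L -> measurable_fun Y D ->
  (\int[lebesgue_measure]_(y in Y) (L y * (f y)%:E) <=
   \int[lebesgue_measure]_(y in Y) (D y * (f y)%:E) + 6%:E)%E.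
Proof.
move=> mL mD; apply: le_trans (log_excess_integral_le mL mD) _.
have L0 y : (0 <= L y)%E by rewrite le_max lexx orbT.
have D0 y : (0 <= D y)%E.
  by rewrite /majorant !adde_ge0// ?lee_fin// ?le_max ?lexx ?orbT.
have fE0 y : (0 <= (f y)%:E)%E by rewrite lee_fin.
apply: leeD.
  apply: ge0_le_integral => //.
  - by move=> y _; rewrite mule_ge0// le_min L0 D0.
  - by apply: emeasurable_funM; [exact: measurable_mine|exact: measurable_density].
  - by apply: emeasurable_funM => //; exact: measurable_density.
  - by move=> y _; rewrite lee_wpmul2r// ge_min lexx orbT.
have sqrt1 (t : R) : 0 <= t <= 1 -> Num.sqrt t <= 1.
  by move=> /andP[t0 t1]; rewrite -sqrtr1 ler_sqrt.
have [a1 a2 a3] := And3 (sqrt1 _ q01) (sqrt1 _ tp01) (sqrt1 _ tm01).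
by rewrite lee_fin; lra.
Qed.

End one_scale.

(** * Convergence to zero *)

Section convergence.
Context (R : realType).
Local Open Scope ereal_scope.

Lemma cvge0_le (u : nat -> \bar R) :
  (forall e : R, (0 < e)%R -> \forall n \near \oo, 0 <= u n <= e%:E) ->
  u @ \oo --> 0.
Proof.
move=> ue; apply/fine_cvgP; split.
  near=> n.
  have : 0 <= u n <= 1%:E by near: n; apply: ue.
  move=> /andP[u0 u1]; rewrite ge0_fin_numE//.
  by rewrite (le_lt_trans u1)// ltry.
apply/cvgrPdist_le => e e0; near=> n.
have : 0 <= u n <= e%:E by near: n; apply: ue.
move=> /andP[u0 une]; rewrite /= sub0r normrN.
have un : u n \is a fin_num by rewrite ge0_fin_numE// (le_lt_trans une)// ltry.
by rewrite ger0_norm ?fine_ge0// -lee_fin fineK.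
Unshelve. all: by end_near. Qed.

Lemma cvge0_near_le (u : nat -> \bar R) : u @ \oo --> 0 ->
  forall e : R, (0 < e)%R -> \forall n \near \oo, u n <= e%:E.
Proof.
move=> /fine_cvgP[ufin /cvgrPdist_le ue] e e0; near=> n.
have un : u n \is a fin_num by near: n.
rewrite -(fineK un) lee_fin (le_trans (ler_norm _))//.
rewrite -normrN -sub0r; near: n; exact: ue.
Unshelve. all: by end_near. Qed.

End convergence.

(** Partitions and bandwidths are controlled from some index on only; the dominated
    convergence theorem is applied to the sequence shifted by [N]. *)
Lemma dominated_cvg_to0 d (T : measurableType d) (R : realType)
    (mu : {measure set T -> \bar R}) (D : set T) (u : nat -> T -> \bar R)
    (g : T -> \bar R) (N : nat) :
  measurable D -> (forall n, (N <= n)%N -> measurable_fun D (u n)) ->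
  (forall n x, (N <= n)%N -> D x -> (0 <= u n x)%E) ->
  {ae mu, forall x, D x -> u ^~ x @ \oo --> 0%E} ->
  measurable_fun D g -> (forall n x, (N <= n)%N -> D x -> (u n x <= g x)%E) ->
  (\int[mu]_(x in D) g x < +oo)%E ->
  (\int[mu]_(x in D) u n x)%E @[n --> \oo] --> 0%E.
Proof.
move=> mD mu_ u0 ucvg mg ug goo.
have g0 x : D x -> (0 <= g x)%E.
  by move=> Dx; apply: le_trans (u0 N x (leqnn N) Dx) (ug N x (leqnn N) Dx).
have ig : mu.-integrable D g.
  apply/integrableP; split => //.
  by rewrite (eq_integral g)// => x /[!inE] Dx; rewrite gee0_abs// g0.
rewrite -(cvg_shiftn N).
have ucvgN : {ae mu, forall x, D x -> (fun n => u (n + N)%N x) @ \oo --> 0%E}.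
  apply: filterS ucvg => x ux Dx.
  by have := ux Dx; rewrite -(cvg_shiftn N).
have ugN : {ae mu, forall x n, D x -> (`|u (n + N)%N x| <= g x)%E}.
  by apply: aeW => x n Dx; rewrite gee0_abs ?u0 ?ug ?leq_addl.
have [_ _] := dominated_convergence mD (fun n => mu_ _ (leq_addl n N))
  (measurable_cst _) ucvgN ig ugN.
by rewrite integral0.
Qed.

(** * The limit in a slice *)

Section slice_limit.
Context (R : realType).
Variables (f : R -> R) (Y : set R) (A : nat -> nat -> set R).
Variables (mu : nat -> nat -> R) (s h p : nat -> R) (s0 r : R) (C : R -> set R).
Hypotheses (mf : measurable_fun setT f) (f0 : forall y, 0 <= f y).
Hypotheses (f1 : mass f setT = 1%E) (mY : measurable Y).
Hypothesis f_off : forall y, ~ Y y -> f y = 0.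
Hypothesis Aitv : forall m j, (0 < j <= m)%N -> is_interval (A m j).
Hypothesis Uitv : forall m, (0 < m)%N -> is_interval (cells_union (A m) m).
Hypothesis Uincr : forall m n, (0 < m <= n)%N ->
  cells_union (A m) m `<=` cells_union (A n) n.
Hypothesis AY : forall m, (0 < m)%N ->
  \bigcup_(j in [set j | (j <= m)%N]) A m j = Y.
Hypothesis Adisj : forall m, (0 < m)%N -> trivIset [set j | (j <= m)%N] (A m).
Hypothesis muA : forall m j, (0 < j <= m)%N -> A m j (mu m j).
Hypothesis Ah : forall m j, (0 < j <= m)%N ->
  (lebesgue_measure (A m j) <= (h m)%:E)%E.
Hypothesis Ap : forall m j, (0 < j <= m)%N -> mass f (A m j) = (p m)%:E.
Hypothesis A0q : forall m, (0 < m)%N ->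
  mass f (A m 0%N) = (1 - m%:R * p m)%:E.
Hypothesis p0 : forall m, (0 < m)%N -> 0 <= p m.
Hypothesis sgt0 : forall m, (0 < m)%N -> 0 < s m.
Hypothesis hge0 : forall m, (0 < m)%N -> 0 <= h m.
Hypothesis s0gt0 : 0 < s0.
Hypothesis mp1 : m%:R * p m @[m --> \oo] --> (1 : R).
Hypothesis scvg : s m @[m --> \oo] --> (0 : R).
Hypothesis hscvg : h m / s m @[m --> \oo] --> (0 : R).
Hypothesis r0 : 0 < r.
Hypothesis Citv : forall y, Y y -> is_interval (C y).
Hypothesis Clen : forall y, Y y -> lebesgue_measure (C y) = r%:E.
Hypothesis Cy : forall y, Y y -> C y y.

Local Notation lam := (@lebesgue_measure R).
Let U m := cells_union (A m) m.
Let q m := 1 - m%:R * p m.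
Let mix m := mixture (mu m) (s m) (p m) (q m) s0 m.
Let D := majorant f C s0 r.
Let L m := log_excess f (mix m).

(** For an increasing sequence of intervals [V m] this says that [y] is interior
    to their union. *)
Definition eventually_inside (V : nat -> set R) (y : R) :=
  exists2 eta, 0 < eta & \forall m \near \oo, V m (y - eta) /\ V m (y + eta).

Let mU m : (0 < m)%N -> measurable (U m).
Proof. by move=> m0; apply: is_interval_measurable; exact: Uitv. Qed.

Let Uoo := \bigcup_(m in [set m | (0 < m)%N]) U m.

Let Uoo_itv : is_interval Uoo.
Proof.
move=> a b [m m0 Ua] [n n0 Ub] z zab; exists (maxn m n).
  by rewrite /= leq_max m0.
apply: (Uitv _ _ _ zab); first by rewrite leq_max m0.
- by apply: (Uincr _ Ua); rewrite m0 leq_maxl.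
- by apply: (Uincr _ Ub); rewrite n0 leq_maxr.
Qed.

Let mUoo : measurable Uoo. Proof. exact: is_interval_measurable. Qed.

Let mass_cells m : (0 < m)%N -> (mass f (U m) = (m%:R * p m)%:E)%E.
Proof.
move=> m0; have A0E := cell0E (AY m0) (Adisj m0).
have mA0 : measurable (A m 0%N) by rewrite A0E; apply: measurableD => //; exact: mU.
have := mass_support f1 f_off.
rewrite (_ : Y = A m 0%N `|` U m); last first.
  rewrite A0E setUC setDUK//.
  by rewrite -(AY m0) => y [j /andP[_ jm] Aj]; exists j.
rewrite massU//; [|exact: mU|by rewrite A0E; apply/disj_setPS => y [[]]].
rewrite A0q// -(fine_massK mf f0 f1 (mU m0)) -EFinD => -[].
by move=> /(congr1 (fun v => v - (1 - m%:R * p m))) => h1; congr EFin; lra.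
Qed.

Let mass_setC_Uoo : mass f (~` Uoo) = 0%E.
Proof.
have mC : measurable (~` Uoo) by exact: measurableC.
have Uoo1 m : (0 < m)%N -> fine (mass f (~` Uoo)) <= 1 - m%:R * p m.
  move=> m0; rewrite -lee_fin fine_massK// EFinB leeBrDr//.
  rewrite -mass_cells// -(mass_setC mf f0 f1 mUoo) addeC leeD2r//.
  by apply: le_mass => //; [exact: mU|move=> y Uy; exists m].
rewrite -fine_massK//; congr EFin; apply/eqP; rewrite eq_le.
have /andP[-> _] := fine_mass_ge0_le1 mf f0 f1 mC; rewrite andbT.
rewrite leNgt; apply/negP => v0.
move/cvgrPdist_lt : mp1 => /(_ _ v0) [M _ MP].
have := MP M.+1 (leqnSn _); rewrite ltNge => /negP; apply.
by rewrite (le_trans (Uoo1 _ (ltn0Sn M)))// ler_norm.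
Qed.

(** The union of all the cells has full mass because [m * p m] tends to 1, and it
    is an interval, so that only its two ends are not interior to it. *)
Lemma ae_eventually_inside :
  {ae lam, forall y, 0 < f y -> eventually_inside U y}.
Proof.
have mC : measurable (~` Uoo) by exact: measurableC.
have off : {ae lam, forall y, (~` Uoo) y -> (f y)%:E = 0%E}.
  have mfC : measurable_fun (~` Uoo) (EFin \o f) by exact: measurable_density.
  have [+ _] := ae_eq_integral_abs lam mC mfC; apply.
  rewrite -[RHS]mass_setC_Uoo; apply: eq_integral => y _.
  by rewrite gee0_abs// lee_fin.
have ne (z : R) : {ae lam, forall y, y <> z}.
  exists [set z]; split; [exact: measurable_set1|exact: lebesgue_measure_set1|].
  by move=> y /= /contrapT.
have FF : Filter (almost_everywhere lam) by exact: ae_filter_ringOfSetsType.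
apply: filterS3 off (ne (inf Uoo)) (ne (sup Uoo)) => y offy yinf ysup fy0.
have Uy : Uoo y.
  by apply: contrapT => /offy [fy]; rewrite fy ltxx in fy0.
have [a Ua ay] : exists2 a, Uoo a & a < y.
  apply: contrapT => /forall2NP H; apply: yinf; apply/eqP; rewrite eq_le.
  have lby : lbound Uoo y.
    by move=> a Ua; case: (H a) => // /negP; rewrite -leNgt.
  by rewrite lb_le_inf//=; [rewrite ge_inf//; exists y|exists y].
have [b Ub yb] : exists2 b, Uoo b & y < b.
  apply: contrapT => /forall2NP H; apply: ysup; apply/eqP; rewrite eq_le.
  have uby : ubound Uoo y.
    by move=> b Ub; case: (H b) => // /negP; rewrite -leNgt.
  by rewrite ge_sup//=; [rewrite andbT ub_le_sup//; exists y|exists y].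
case: Ua => m1 m10 Ua; case: Ub => m2 m20 Ub.
exists (Num.min (y - a) (b - y)); first by rewrite lt_min !subr_gt0 ay.
exists (maxn m1 m2) => // m /=; rewrite geq_max => /andP[m1m m2m].
have m0 : (0 < m)%N by exact: leq_trans m1m.
have Uam : U m a by apply: (Uincr _ Ua); rewrite m10.
have Ubm : U m b by apply: (Uincr _ Ub); rewrite m20.
set eta := Num.min _ _.
have [ea eb] : eta <= y - a /\ eta <= b - y.
  by split; rewrite /eta ge_min lexx ?orbT.
have e0 : 0 < eta by rewrite lt_min !subr_gt0 ay.
by split; apply: (Uitv m0 Uam Ubm); apply/andP; split; lra.
Qed.

(** Almost every point is eventually farther than [s m] from both ends. *)
Lemma edge_vanish (e : nat -> R) : (forall m, (0 < m)%N -> `|e m| = s m) ->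
  mass f (edge (U m) (e m)) @[m --> \oo] --> 0%E.
Proof.
move=> es.
rewrite (_ : (fun m => _) = (fun m =>
  \int[lam]_(y in setT) ((EFin \o f) \_ (edge (U m) (e m)) y))%E); last first.
  by apply/funext => m; rewrite /mass [LHS]integral_mkcond.
apply: (@dominated_cvg_to0 _ (measurableTypeR R) R lam setT
  (fun m => (EFin \o f) \_ (edge (U m) (e m))) (EFin \o f) 1%N) => //.
- move=> m m0.
  have mE : measurable (edge (U m) (e m)) by apply: measurable_edge; exact: mU.
  by have [+ _] := measurable_restrictT (EFin \o f) mE; apply; exact: measurable_density.
- by move=> m y _ _; rewrite patchE; case: ifPn => // _; rewrite lee_fin.
- have FF : Filter (almost_everywhere lam) by exact: ae_filter_ringOfSetsType.
  apply: filterS ae_eventually_inside => y inside _.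
  apply: cvg_near_cst.
  have := f0 y; rewrite le_eqVlt => /predU1P[fy|/inside [eta eta0 [M _ MU]]].
    by apply: nearW => m; rewrite patchE/= -fy; case: ifPn.
  move/cvgrPdist_lt : scvg => /(_ _ eta0) [M' _ Ms].
  exists (maxn (maxn M M') 1) => // m /=; rewrite !geq_max => /andP[/andP[Mm M'm] m0].
  have [Um Up] := MU m Mm; have := Ms m M'm; rewrite /= sub0r normrN => sm.
  rewrite patchE memNset// => -[_]; apply.
  apply: (Uitv m0 Um Up).
  have := es m m0; have := ler_norm (s m); have := ler_norm (e m).
  have := ler_norm (- e m); rewrite normrN => *; apply/andP; split; lra.
- exact: measurable_density.
- by move=> m y _ _; rewrite patchE; case: ifPn => // _; rewrite lee_fin.
- by rewrite -[X in (X < _)%E]/(mass f setT) f1 ltry.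
Qed.

(** At an interior point of continuity the Riemann sum over a fixed window is at
    least the convolution of a function nearly equal to [f y] with a normal
    density of small standard deviation.  Four factors close to 1 are lost: the
    oscillation of [f] on the window, the shrinking and the displacement of the
    normal densities, and the mass outside the window. *)
Lemma mixture_lower y eps : eventually_inside U y -> 0 < f y ->
  {for y, continuous f} -> 0 < eps ->
  \forall m \near \oo, expR (- eps) * f y <= mix m y.
Proof.
move=> [eta0 eta00 [M _ MU]] fy0 fy_cont eps0.
(* a bounds each of the four factors from below; a ^ 4 = expR (- eps) *)
pose a := expR (- (eps / 4)).
have a0 : 0 < a by exact: expR_gt0.
have eps4 : 0 < eps / 4 by rewrite divr_gt0.
have a1 : a < 1 by rewrite expR_lt1 oppr_lt0.
have a4 : expR (- eps) = a * a * (a * a).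
  by rewrite /a -!expRD; congr expR; field.
have a10 : 0 < 1 - a by rewrite subr_gt0.
have [d /= d0 fd] : exists2 d, 0 < d & forall z, `|y - z| < d -> a * f y <= f z.
  have /cvgrPdist_le/(_ (f y * (1 - a))) := fy_cont.
  rewrite mulr_gt0// => /(_ isT)/nbhs_ballP[d d0 fd]; exists d => // z yz.
  have := fd z yz; rewrite /= => /(le_trans (ler_norm _)); lra.
pose eta := Num.min eta0 (d / 2).
have eta_gt0 : 0 < eta by rewrite lt_min eta00 divr_gt0.
have [eta_le0 eta_led] : eta <= eta0 /\ eta <= d / 2.
  by rewrite !ge_min !lexx orbT.
have [k1 k2] : 0 < Num.min 1 (eps / 4 * (2 * (1 - a))) /\
    0 < Num.min 1 ((1 - a) / 6) * eta.
  by rewrite mulr_gt0// !lt_min !ltr01/= ?divr_gt0 ?mulr_gt0.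
move/cvgrPdist_le : hscvg => /(_ _ k1) [M1 _ hsM].
move/cvgrPdist_le : scvg => /(_ _ k2) [M2 _ sM].
exists (maxn (maxn M1 M2) (maxn M 1)) => // m /=.
rewrite !geq_max => /andP[/andP[M1m M2m] /andP[Mm m0]].
have sm0 := sgt0 m0; have hm0 := hge0 m0.
have [Um Up] := MU m Mm.
have hs1 : (h m / s m) ^+ 2 / (2 * (1 - a)) <= eps / 4.
  have := hsM m M1m; rewrite /= sub0r normrN ger0_norm ?divr_ge0 ?(ltW sm0)//.
  rewrite le_min => /andP[hs1 hs2]; rewrite ler_pdivrMr ?mulr_gt0//.
  by apply: le_trans hs2; rewrite expr2 ler_piMl// divr_ge0// ltW.
have window : a <= 1 - 6 * (a * s m / eta) ^+ 2.
  have := sM m M2m; rewrite /= sub0r normrN gtr0_norm//.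
  rewrite -ler_pdivrMr// le_min => /andP[s1 s2].
  have se0 : 0 <= s m / eta by rewrite divr_ge0 ?ltW.
  have : (s m / eta) ^+ 2 <= (1 - a) / 6.
    by apply: le_trans s2; rewrite expr2 ler_piMl.
  have : (a * s m / eta) ^+ 2 <= (s m / eta) ^+ 2.
    rewrite -mulrA exprMn ler_piMl ?sqr_ge0//.
    by rewrite expr_le1 ?(ltW a0)// ltW.
  by lra.
pose E := expR (- ((h m / s m) ^+ 2 / (2 * (1 - a)))).
have aE : a <= E by rewrite ler_expR lerN2.
have E0 : 0 < E by exact: expR_gt0.
pose S : set R := `[y - eta, y + eta]%classic.
have mS : measurable S by exact: measurable_itv.
pose psi z := a * E * normal_pdf y (a * s m) z.
have mpsi : measurable_fun setT psi.
  by apply: measurable_funM => //; exact: measurable_normal_pdf.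
have psi0 z : 0 <= psi z by rewrite !mulr_ge0 ?normal_pdf_ge0 ?ltW.
have SU : S `<=` U m.
  move=> z; rewrite /S/= in_itv/= => /andP[z1 z2].
  by apply: (Uitv m0 Um Up); apply/andP; split; lra.
have psi_le j z : (0 < j <= m)%N -> A m j z -> S z ->
    psi z <= normal_pdf (mu m j) (s m) y.
  move=> jm Az _; apply: normal_pdf_recentre => //; first by rewrite a0.
  apply: (cell_mu_dist (m := m)) jm Az => j' jm'; first exact: Aitv.
    exact: muA.
  exact: Ah.
have Sf z : S z -> a * f y <= f z.
  rewrite /S/= in_itv/= => zS; apply: fd.
  have : `|z - y| <= eta by rewrite ler_distl.
  by rewrite distrC; lra.
have low : ((a * a * (a * a) * f y)%:E <= (bumps (mu m) (s m) (p m) m y)%:E)%E.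
  apply: le_trans (bumps_ge_integral (A := A m) mf f0 _ _ _ mS SU mpsi psi0 psi_le).
  - apply: (@le_trans _ _ (\int[lam]_(z in S)
        ((a * f y * (a * E))%:E * (normal_pdf y (a * s m) z)%:E)))%E.
      rewrite ge0_integralZl//; last 3 first.
      + apply: measurable_funTS; apply/measurable_EFinP.
        exact: measurable_normal_pdf.
      + by move=> z _; rewrite lee_fin normal_pdf_ge0.
      + by rewrite lee_fin !mulr_ge0// ltW.
      have c0 : 0 <= a * f y * (a * E) by rewrite !mulr_ge0// ltW.
      have as0 : 0 < a * s m by rewrite mulr_gt0.
      apply: (@le_trans _ _ ((a * f y * (a * E))%:E * a%:E)%E); last first.
        rewrite lee_wpmul2l// ?lee_fin//.
        apply: le_trans (normal_window y as0 eta_gt0).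
        by rewrite lee_fin.
      rewrite -EFinM lee_fin.
      rewrite (_ : _ * f y = (a * f y * (a * a)) * a); last by ring.
      by rewrite ler_wpM2r ?(ltW a0)// ler_wpM2l ?mulr_ge0 ?(ltW a0)// ler_wpM2l ?(ltW a0).
    apply: ge0_le_integral => //.
    + by move=> z _; rewrite mule_ge0// lee_fin ?normal_pdf_ge0// !mulr_ge0// ltW.
    + apply: measurable_funeM; apply: measurable_funTS; apply/measurable_EFinP.
      exact: measurable_normal_pdf.
    + by apply: measurable_funTS; apply/measurable_EFinP; exact: measurable_funM.
    + move=> z Sz; rewrite -EFinM lee_fin /psi [leRHS]mulrA.
      rewrite ler_wpM2r ?normal_pdf_ge0//.
      by rewrite ler_wpM2r ?mulr_ge0 ?(ltW a0) ?(ltW E0)//; exact: Sf.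
  - by move=> j; exact: Aitv.
  - exact: Adisj.
  - by move=> j; exact: Ap.
rewrite a4; rewrite lee_fin in low; apply: le_trans low _.
rewrite lerDl mulr_ge0 ?normal_pdf_ge0// -lee_fin -(A0q m0).
exact: mass_ge0.
Qed.

Hypothesis fcont : {ae lam, forall y, 0 < f y -> {for y, continuous f}}.
Hypothesis mL : forall m, (0 < m)%N -> measurable_fun Y (L m).
Hypothesis mD : measurable_fun Y D.
Hypothesis Doo : (\int[lam]_(y in Y) (D y * (f y)%:E) < +oo)%E.

Let sqrt_cvg0 (v : nat -> R) : v @ \oo --> (0 : R) ->
  2 * Num.sqrt (v m) @[m --> \oo] --> (0 : R).
Proof.
move=> v0; rewrite -(mulr0 2) -(@sqrtr0 R); apply: cvgMr.
exact: (continuous_cvg _ (@sqrt_continuous R 0) v0).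
Qed.

Let edge_sqrt_cvg0 (e : nat -> R) : (forall m, (0 < m)%N -> `|e m| = s m) ->
  2 * Num.sqrt (fine (mass f (edge (U m) (e m)))) @[m --> \oo] --> (0 : R).
Proof. by move=> es; apply: sqrt_cvg0; apply: fine_cvg; exact: edge_vanish. Qed.

Lemma log_excess_pointwise_cvg0 y : eventually_inside U y -> 0 < f y ->
  {for y, continuous f} -> (L m y)%E @[m --> \oo] --> 0%E.
Proof.
move=> inside fy0 fy_cont; apply: cvge0_le => e e0.
apply: filterS (mixture_lower inside fy0 fy_cont e0) => m mixm.
rewrite /L /log_excess le_max lexx orbT/= ge_max lee_fin (ltW e0) andbT.
have w0 : 0 < expR (- e) * f y by rewrite mulr_gt0// expR_gt0.
apply: le_trans (lne_div_le fy0 w0 mixm) _.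
by rewrite invfM mulrCA divff ?gt_eqF// mulr1 -expRN opprK expRK.
Qed.

(** The integral of min (L, D) tends to 0 by dominated convergence, and the tail
    cell and the edges have vanishing mass. *)
Lemma log_excess_cvg0 :
  (\int[lam]_(y in Y) (L m y * (f y)%:E))%E @[m --> \oo] --> 0%E.
Proof.
have L0 m y : (0 <= L m y)%E by rewrite le_max lexx orbT.
have D0 y : (0 <= D y)%E.
  by rewrite /D /majorant !adde_ge0// ?lee_fin// ?le_max ?lexx ?orbT.
have fE0 y : (0 <= (f y)%:E)%E by rewrite lee_fin.
have min_cvg0 : (\int[lam]_(y in Y) (mine (L m y) (D y) * (f y)%:E))%E
    @[m --> \oo] --> 0%E.
  apply: (@dominated_cvg_to0 _ (measurableTypeR R) R lam Y
    (fun m y => mine (L m y) (D y) * (f y)%:E)%E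
    (fun y => D y * (f y)%:E)%E 1%N) => //.
  - move=> m m0; apply: emeasurable_funM; last exact: measurable_density.
    by apply: measurable_mine => //; exact: mL.
  - by move=> m y _ _; rewrite mule_ge0// le_min L0 D0.
  - have FF : Filter (almost_everywhere lam) by exact: ae_filter_ringOfSetsType.
    apply: filterS2 ae_eventually_inside fcont => y inside fy_cont _.
    have := f0 y; rewrite le_eqVlt => /predU1P[<-|fy0].
      by under eq_fun do rewrite mule0; exact: cvg_cst.
    have Ly := log_excess_pointwise_cvg0 (inside fy0) fy0 (fy_cont fy0).
    apply: (@squeeze_cvge _ _ _ _ (cst 0%E) _ (fun m => L m y * (f y)%:E)%E).
    + apply: nearW => m; rewrite mule_ge0 ?le_min ?L0 ?D0//=.
      by rewrite lee_wpmul2r// ge_min lexx.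
    + exact: cvg_cst.
    + by rewrite -(mul0e (f y)%:E); apply: cvgeZr.
  - by apply: emeasurable_funM => //; exact: measurable_density.
  - by move=> m y _ _; rewrite lee_wpmul2r// ge_min lexx orbT.
have [k1 k2] : 0 < r / 2 /\ 0 < (1 : R) by rewrite divr_gt0.
move/cvgrPdist_le : scvg => /(_ _ k1) [M1 _ sM].
move/cvgrPdist_le : hscvg => /(_ _ k2) [M2 _ hsM].
apply: (@squeeze_cvge _ _ _ _ (cst 0%E) _ (fun m =>
  \int[lam]_(y in Y) (mine (L m y) (D y) * (f y)%:E) +
  (2 * Num.sqrt (q m) +
   2 * Num.sqrt (fine (mass f (edge (U m) (s m)))) +
   2 * Num.sqrt (fine (mass f (edge (U m) (- s m)))))%:E)%E).
- exists (maxn (maxn M1 M2) 1) => // m /=.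
  rewrite !geq_max => /andP[/andP[M1m M2m] m0].
  rewrite integral_ge0/=; last by move=> y _; rewrite mule_ge0.
  have sm0 := sgt0 m0; have hm0 := hge0 m0.
  apply: (@log_excess_integral_le _ _ _ (A m) _ _ _ (h m)) => //.
  + by move=> j; exact: Aitv.
  + exact: Uitv.
  + exact: AY.
  + exact: Adisj.
  + by move=> j; exact: muA.
  + by move=> j; exact: Ah.
  + by move=> j; exact: Ap.
  + exact: A0q.
  + exact: p0.
  + have := hsM m M2m; rewrite /= sub0r normrN ger0_norm ?divr_ge0 ?(ltW sm0)//.
    by rewrite ler_pdivrMr// mul1r.
  + have := sM m M1m; rewrite /= sub0r normrN gtr0_norm//.
    by rewrite ler_pdivlMr// mulrC.
  + exact: mL.
- exact: cvg_cst.
- rewrite -[X in _ --> X]add0e; apply: cvgeD => //.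
  apply: cvg_EFin; first exact: nearW.
  rewrite [X in X @ _](_ : _ = (fun m => 2 * Num.sqrt (q m) +
   2 * Num.sqrt (fine (mass f (edge (U m) (s m)))) +
   2 * Num.sqrt (fine (mass f (edge (U m) (- s m))))))//.
  rewrite -[X in _ --> X](addr0 (0 : R)) -[X in _ --> X + _](addr0 (0 : R)).
  apply: cvgD; first apply: cvgD.
  + apply: sqrt_cvg0; rewrite /q -(subrr (1 : R)).
    by apply: cvgB => //; exact: cvg_cst.
  + by apply: edge_sqrt_cvg0 => m m0; rewrite gtr0_norm// sgt0.
  + by apply: edge_sqrt_cvg0 => m m0; rewrite normrN gtr0_norm// sgt0.
Qed.

End slice_limit.

(** * Measurability and Gibbs' inequality *)

Section measurability.
Context (R : realType).

Lemma measurable_lne : measurable_fun setT (@lne R).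
Proof.
rewrite (_ : @lne R = fun e : \bar R => if (e <= 0)%E then -oo%E else
    if e == +oo%E then +oo%E else (ln (fine e))%:E); last first.
  by apply/funext => -[t||] //=; rewrite leNye.
apply: measurable_fun_ifT; first exact: measurable_fun_lee.
  exact: measurable_cst.
apply: measurable_fun_ifT; first exact: measurable_fun_eqe.
  exact: measurable_cst.
apply/measurable_EFinP; apply: measurableT_comp; first exact: measurable_ln.
exact: fine_measurable.
Qed.

Lemma measurable_ediv d (T : measurableType d) (E : set T) (a b : T -> R) :
  measurable E -> measurable_fun E a -> measurable_fun E b ->
  (forall t, E t -> 0 <= b t) ->
  measurable_fun E (fun t => (a t)%:E / (b t)%:E)%E.
Proof.
move=> mE ma mb b0; apply: emeasurable_funM; first exact/measurable_EFinP.
(* on nonnegative reals the inverse is the power -1 *)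
apply: (eq_measurable_fun
  (fun t => if b t == 0 then +oo%E else (b t `^ (-1))%:E)) => [t /set_mem Et|].
  rewrite inver; case: ifPn => // bt0.
  by rewrite powR_inv1// b0.
apply: measurable_fun_if => //.
- by apply: measurable_fun_eqr.
- apply/measurable_EFinP; apply: (measurable_funS mE); first exact: subIsetl.
  exact: (measurableT_comp (measurable_powR (-1)) mb).
Qed.

Lemma measurable_slice d (T : measurableType d) (Y : set R) (X : set T)
    (g : R * T -> \bar R) x : measurable Y -> measurable X ->
  measurable_fun (Y `*` X) g -> X x -> measurable_fun Y (fun y => g (y, x)).
Proof.
move=> mY mX mg Xx.
have mYX : measurable (Y `*` X) by exact: measurableX.
have [+ _] := measurable_restrictT g mYX; move=> /(_ mg) mgr.
have := measurable_funTS (D := Y) (measurableT_comp mgr (pair2_measurable x)).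
apply: eq_measurable_fun => y /set_mem Yy.
by rewrite /= patchE mem_set.
Qed.

End measurability.

Section gibbs.
Context (R : realType).
Local Notation lam := (@lebesgue_measure R).

Lemma measurable_mixture (mu : nat -> R) (s p q s0 : R) m :
  measurable_fun setT (mixture mu s p q s0 m).
Proof.
apply: measurable_funD.
  apply: measurable_sum => j; apply: measurable_funM => //.
  exact: measurable_normal_pdf.
by apply: measurable_funM => //; exact: measurable_normal_pdf.
Qed.

Lemma mixture_gt0 (mu : nat -> R) (s p q s0 : R) m y : (0 < m)%N -> 0 < s ->
  0 < p -> 0 <= q -> 0 < mixture mu s p q s0 m y.
Proof.
move=> m0 s0' p0 q0; rewrite /mixture ltr_pwDl ?mulr_ge0 ?normal_pdf_ge0//.
rewrite /bumps big_ltn// ltr_pwDl//; first by rewrite mulr_gt0// normal_pdf_gt0.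
by apply: sumr_ge0 => j _; rewrite mulr_ge0 ?normal_pdf_ge0// ltW.
Qed.

Lemma integral_mixture (mu : nat -> R) (s p q s0 : R) m : 0 <= p -> 0 <= q ->
  (\int[lam]_y (mixture mu s p q s0 m y)%:E = (m%:R * p + q)%:E)%E.
Proof.
move=> p0 q0.
have mpdf c t : measurable_fun setT (fun y : R => (normal_pdf c t y)%:E).
  by apply/measurable_EFinP; exact: measurable_normal_pdf.
have pint k c t : 0 <= k ->
    (\int[lam]_y (k%:E * (normal_pdf c t y)%:E) = k%:E)%E.
  move=> k0; rewrite ge0_integralZl//; first by rewrite integral_normal_pdf mule1.
    exact: mpdf.
  by move=> y _; rewrite lee_fin normal_pdf_ge0.
under eq_integral do rewrite /mixture EFinD EFinM /bumps -sumEFin.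
rewrite ge0_integralD//; last 4 first.
- by move=> y _; apply: sume_ge0 => j _; rewrite lee_fin mulr_ge0 ?normal_pdf_ge0.
- apply: emeasurable_sum => j; under eq_fun do rewrite EFinM.
  by apply: measurable_funeM; exact: mpdf.
- by move=> y _; rewrite mule_ge0// lee_fin// normal_pdf_ge0.
- by apply: measurable_funeM; exact: mpdf.
rewrite pint// ge0_integral_sum//; last 2 first.
- by move=> j; under eq_fun do rewrite EFinM; apply: measurable_funeM; exact: mpdf.
- by move=> j y _; rewrite lee_fin mulr_ge0 ?normal_pdf_ge0.
rewrite EFinD; congr (_ + _)%E.
under eq_bigr do (under eq_integral do rewrite EFinM; rewrite pint//).
by rewrite sumEFin big_const_nat iter_addr_0 subSS subn0 mulr_natl.
Qed.

(** Gibbs' inequality in the form (log w)^+ + 1 <= (log w)^- + w with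
    [w = g / f], which is log w <= w - 1.  The two parts of the log-likelihood
    ratio are integrated separately because either integral may be [+oo]. *)
Lemma gibbs (f g : R -> R) (Y : set R) : measurable Y -> measurable_fun setT f ->
  measurable_fun setT g -> (forall y, 0 <= f y) -> (forall y, 0 < g y) ->
  (\int[lam]_(y in Y) (f y)%:E = 1)%E -> (\int[lam]_(y in Y) (g y)%:E <= 1)%E ->
  measurable_fun Y (log_excess f g) ->
  measurable_fun Y (fun y => maxe (- lne ((f y)%:E / (g y)%:E)) 0)%E ->
  (\int[lam]_(y in Y) (maxe (- lne ((f y)%:E / (g y)%:E)) 0 * (f y)%:E) <=
   \int[lam]_(y in Y) (log_excess f g y * (f y)%:E))%E.
Proof.
move=> mY mf mg f0 g0 f1 g1 mL mN.
set N := fun y : R => maxe (- lne ((f y)%:E / (g y)%:E))%E 0%E.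
have L0 y : (0 <= log_excess f g y)%E by rewrite le_max lexx orbT.
have N0 y : (0 <= N y)%E by rewrite le_max lexx orbT.
have fE y : (0 <= (f y)%:E)%E by rewrite lee_fin.
have gE y : (0 <= (g y)%:E)%E by rewrite lee_fin ltW.
have mfE := measurable_density mf (D := Y); have mgE := measurable_density mg (D := Y).
have mNf : measurable_fun Y (fun y => N y * (f y)%:E)%E by exact: emeasurable_funM.
have mLf : measurable_fun Y (fun y => log_excess f g y * (f y)%:E)%E.
  exact: emeasurable_funM.
rewrite -(@leeD2rE _ 1%E)//.
apply: (@le_trans _ _ (\int[lam]_(y in Y) (log_excess f g y * (f y)%:E) +
   \int[lam]_(y in Y) (g y)%:E)%E); last exact: leeD2l.
rewrite -[X in (_ + X <= _)%E]f1 -!ge0_integralD//; last 2 first.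
- by move=> y _; rewrite mule_ge0.
- by move=> y _; apply: mule_ge0 => //; exact: N0.
apply: ge0_le_integral => //.
- by move=> y _; rewrite adde_ge0//; apply: mule_ge0 => //; exact: N0.
- exact: emeasurable_funD.
- exact: emeasurable_funD.
move=> y _; have := f0 y; rewrite le_eqVlt => /predU1P[<-|fy0].
  by rewrite !mule0 !add0e.
rewrite /N /log_excess inver gt_eqF// -EFinM lne_EFin ?divr_gt0//.
rewrite -EFinN -!EFin_max -!EFinM -!EFinD lee_fin.
set w := g y / f y; have w0 : 0 < w by rewrite divr_gt0.
have -> : f y / g y = w^-1 by rewrite /w invf_div.
have -> : g y = w * f y by rewrite /w divfK// gt_eqF.
rewrite lnV ?posrE// opprK -[X in _ + X <= _]mul1r -!mulrDl ler_wpM2r//.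
have lnw : ln w <= w - 1.
  have := @le_ln1Dx R (w - 1); rewrite (_ : 1 + (w - 1) = w); last by ring.
  by apply; lra.
case: (boolP (0 <= ln w)) => [lw|]; last rewrite -ltNge => /ltW lw.
  by rewrite (max_l lw) max_r; lra.
by rewrite (max_r lw) max_l; lra.
Qed.

End gibbs.

Section marginal.
Context d (T : measurableType d) (R : realType).

Let snd_mixin := isMeasurableFun.Build _ _ (R * T)%type T snd
  (@measurable_snd _ _ R T).

Let snd_mfun : {mfun (R * T)%type >-> T} := HB.pack (@snd R T) snd_mixin.

Definition marginal (F : probability (R * T)%type R) : probability T R :=
  distribution F snd_mfun.

End marginal.

Lemma integral_maxE d (T : measurableType d) (R : realType)
    (mu : {measure set T -> \bar R})
    (E : set T) (g : T -> \bar R) :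
  (\int[mu]_(t in E) g t =
   \int[mu]_(t in E) maxe (g t) 0 - \int[mu]_(t in E) maxe (- g t) 0)%E.
Proof.
rewrite integralE; congr (_ - _)%E; apply: eq_integral => t _.
  by rewrite funeposE.
by rewrite funenegE.
Qed.

(** * Convergence of the divergence *)

Theorem proposition5p1 (R : realType) (dx : nat)
  (Y : set R) (X : set (dx.-tuple R))
  (F : probability (R * dx.-tuple R)%type R)
  (f : R -> dx.-tuple R -> R)
  (nu : {measure set (dx.-tuple R) -> \bar R})
  (fX : dx.-tuple R -> R)
  (A : nat -> nat -> dx.-tuple R -> set R)
  (mu : nat -> nat -> dx.-tuple R -> R)
  (h delta sigma : nat -> dx.-tuple R -> R)
  (sigma0 : dx.-tuple R -> R)
  (p : nat -> R)
  (r : dx.-tuple R -> R)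
  (C : R -> dx.-tuple R -> set R)
  (* the distribution F on Y * X *)
  (mY : measurable Y) (mX : measurable X)
  (FYX : F (Y `*` X) = 1%E)
  (fP : conditional_density F Y X f)
  (fXP : marginal_density F X nu fX)
  (* the partitions and the model *)
  (AP : interval_partitions Y X A)
  (muP : forall m j x, (0 < j <= m)%N -> X x -> A m j x (mu m j x))
  (hP : forall m j x, (0 < j <= m)%N -> X x ->
     (lebesgue_measure (A m j x) <= (h m x)%:E)%E)
  (h_gt0 : forall m x, (0 < m)%N -> X x -> 0 < h m x)
  (delta_gt0 : forall m x, (0 < m)%N -> X x -> 0 < delta m x)
  (sigma_gt0 : forall m x, (0 < m)%N -> X x -> 0 < sigma m x)
  (sigma0_gt0 : forall x, X x -> 0 < sigma0 x)
  (mmodel : forall m, (0 < m)%N ->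
     measurable_fun (Y `*` X)
       (fun z => model4 f A mu sigma sigma0 m z.1 z.2))
  (* condition 1 *)
  (pP : forall m, (0 < m)%N -> 0 < p m <= m%:R^-1)
  (Fj : forall m j x, (0 < j <= m)%N -> X x ->
     cond_prob f (A m j x) x = (p m)%:E)
  (F0 : forall m x, (0 < m)%N -> X x ->
     cond_prob f (A m 0%N x) x = (1 - m%:R * p m)%:E)
  (mp1 : m%:R * p m @[m --> \oo] --> (1 : R))
  (delta0 : forall x, X x -> delta m x @[m --> \oo] --> (0 : R))
  (sigma_delta0 : forall x, X x -> sigma m x / delta m x @[m --> \oo] --> (0 : R))
  (h_sigma0 : forall x, X x -> h m x / sigma m x @[m --> \oo] --> (0 : R))
  (* condition 2 *)
  (fcont : {ae F, forall z, {for z.1, continuous (fun y => f y z.2)}})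
  (* condition 3 *)
  (r_gt0 : forall x, X x -> 0 < r x)
  (CP : forall y x, Y y -> X x -> interval_of_length (C y x) (r x) /\ C y x y)
  (minf : measurable_fun (Y `*` X)
     (fun z => inf [set f w z.2 | w in C z.1 z.2]))
  (Cint : (\int[F]_(z in Y `*` X)
     lne ((f z.1 z.2)%:E / (inf [set f w z.2 | w in C z.1 z.2])%:E) < +oo)%E)
  (Chalf : forall y x, Y y -> X x -> exists M, forall m, (M <= m)%N ->
     (A m 0%N x y -> exists C0, [/\ interval_of_length C0 (r x / 2),
        has_end C0 y & C0 `<=` C y x `&` A m 0%N x]) /\
     ((Y `\` A m 0%N x) y -> exists C1, [/\ interval_of_length C1 (r x / 2),
        has_end C1 y & C1 `<=` C y x `&` (Y `\` A m 0%N x)]))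
  (* condition 4 *)
  (sup_sigma_r : ereal_sup [set (sigma m x / r x)%:E | x in X]
     @[m --> \oo] --> (0%E))
  (sup_h_sigma : ereal_sup [set (h m x / sigma m x)%:E | x in X]
     @[m --> \oo] --> (0%E))
  (* condition 5 *)
  (phi_r : forall y x, Y y -> X x -> normal_pdf 0 (sigma0 x) y * r x / 2 <= 4^-1)
  (* condition 6 *)
  (mphi_r : measurable_fun (Y `*` X)
     (fun z => normal_pdf 0 (sigma0 z.2) z.1 * r z.2 / 2))
  (phi_r_int : (`| \int[F]_(z in Y `*` X)
     (ln (normal_pdf 0 (sigma0 z.2) z.1 * r z.2 / 2))%:E | < +oo)%E) :
  dKL F Y X f (model4 f A mu sigma sigma0 m) @[m --> \oo] --> (0%E : \bar R).
Proof.
case: fP => f0 foff f1 mf fF; case: AP => AY Adisj Aitv Uitv Uincr.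
pose Q := marginal F.
have FE (B : set R) (E : set (dx.-tuple R)) : measurable B -> measurable E ->
    E `<=` X -> F (B `*` E) =
    (\int[Q]_(x in E) \int[lebesgue_measure]_(y in B) (f y x)%:E)%E.
  exact: fF.
have dis := disintegration mY mX FYX f0 mf FE.
have mYX : measurable (Y `*` X) by exact: measurableX.
have mfx x : X x -> measurable_fun setT (f^~ x).
  move=> Xx; apply/measurable_EFinP.
  apply: (@measurable_slice _ _ _ setT X (fun z => (f z.1 z.2)%:E)) => //.
  exact/measurable_EFinP.
have mfYX : measurable_fun (Y `*` X) (fun z => f z.1 z.2).
  by apply: measurable_funS mf; [exact: measurableX|move=> z []].
pose q m : R := 1 - m%:R * p m.
pose mix m x := mixture (mu m ^~ x) (sigma m x) (p m) (q m) (sigma0 x) m.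
have q0 m : (0 < m)%N -> 0 <= q m.
  move=> m0; have /andP[_] := pP m m0.
  by rewrite /q subr_ge0 -div1r ler_pdivlMr ?ltr0n// mulrC.
have p0 m : (0 < m)%N -> 0 < p m by move=> /pP/andP[].
have mix_gt0 m y x : (0 < m)%N -> X x -> 0 < mix m x y.
  by move=> m0 Xx; apply: mixture_gt0 => //; [exact: sigma_gt0|exact: p0|exact: q0].
have modelE m y x : (0 < m)%N -> X x ->
    model4 f A mu sigma sigma0 m y x = (mix m x y)%:E.
  move=> m0 Xx; rewrite /model4 F0// -EFinM /mix /mixture EFinD; congr (_ + _)%E.
  rewrite /bumps -sumEFin big_seq [RHS]big_seq; apply: eq_bigr => j.
  by rewrite mem_index_iota => jm; rewrite Fj// EFinM.
pose ell m z := lne ((f z.1 z.2)%:E / model4 f A mu sigma sigma0 m z.1 z.2).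
have mell m : (0 < m)%N -> measurable_fun (Y `*` X) (ell m).
  move=> m0; apply: (measurableT_comp (@measurable_lne R)).
  apply: (eq_measurable_fun (fun z => (f z.1 z.2)%:E /
      (fine (model4 f A mu sigma sigma0 m z.1 z.2))%:E)%E).
    by move=> [y x] /set_mem[/= Yy Xx]; rewrite modelE.
  apply: measurable_ediv => //.
    by apply: measurableT_comp (mmodel m m0) => //; exact: fine_measurable.
  by move=> [y x] [/= Yy Xx]; rewrite modelE//= ltW// mix_gt0.
pose L m z : \bar R := maxe (ell m z) 0%E.
pose N m z : \bar R := maxe (- ell m z)%E 0%E.
have L0 m z : (0 <= L m z)%E by rewrite le_max lexx orbT.
have N0 m z : (0 <= N m z)%E by rewrite le_max lexx orbT.
have mL m : (0 < m)%N -> measurable_fun (Y `*` X) (L m).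
  by move=> m0; apply: measurable_maxe; [exact: mell|exact: measurable_cst].
have mN m : (0 < m)%N -> measurable_fun (Y `*` X) (N m).
  move=> m0; apply: measurable_maxe; last exact: measurable_cst.
  by apply: measurableT_comp (mell m m0).
have LE m y x : (0 < m)%N -> X x ->
    L m (y, x) = log_excess (f^~ x) (mix m x) y.
  by move=> m0 Xx; rewrite /L /ell /= modelE.
have NE m y x : (0 < m)%N -> X x ->
    N m (y, x) = maxe (- lne ((f y x)%:E / (mix m x y)%:E))%E 0%E.
  by move=> m0 Xx; rewrite /N /ell /= modelE.
have mLx m x : (0 < m)%N -> X x ->
    measurable_fun Y (log_excess (f^~ x) (mix m x)).
  move=> m0 Xx; apply: eq_measurable_fun (measurable_slice mY mX (mL m m0) Xx).
  by move=> y _; rewrite LE.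
have mNx m x : (0 < m)%N -> X x ->
    measurable_fun Y (fun y => maxe (- lne ((f y x)%:E / (mix m x y)%:E)) 0)%E.
  move=> m0 Xx; apply: eq_measurable_fun (measurable_slice mY mX (mN m m0) Xx).
  by move=> y _; rewrite NE.
(* The majorant is integrable by the hypotheses on C and on the last component. *)
pose D (z : R * dx.-tuple R) :=
  majorant (f^~ z.2) (C ^~ z.2) (sigma0 z.2) (r z.2) z.1.
have D0 z : (0 <= D z)%E.
  by rewrite /D /majorant !adde_ge0// ?lee_fin ?le_max ?lexx ?orbT.
pose i (z : R * dx.-tuple R) := inf [set f w z.2 | w in C z.1 z.2].
have i0 z : (Y `*` X) z -> 0 <= i z.
  case: z => y x [/= Yy Xx]; have [_ Cyx] := CP y x Yy Xx.
  apply: lb_le_inf; first by exists (f y x) => /=; exists y.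
  by move=> _ [w _ <-]; exact: f0.
have i_le z : (Y `*` X) z -> i z <= f z.1 z.2.
  case: z => y x [/= Yy Xx]; have [_ Cyx] := CP y x Yy Xx.
  by apply: ge_inf; [exists 0 => _ [w _ <-]; exact: f0|exists y].
pose psi z := lne ((f z.1 z.2)%:E / (i z)%:E).
have mpsi : measurable_fun (Y `*` X) psi.
  apply: (measurableT_comp (@measurable_lne R)).
  by apply: measurable_ediv.
pose g (z : R * dx.-tuple R) := normal_pdf 0 (sigma0 z.2) z.1 * r z.2 / 2.
have g0 z : (Y `*` X) z -> 0 < g z.
  case: z => y x [/= Yy Xx]; rewrite /g/= divr_gt0// mulr_gt0 ?r_gt0//.
  by apply: normal_pdf_gt0; exact: sigma0_gt0.
have mlng : measurable_fun (Y `*` X) (fun z => (ln (g z))%:E).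
  by apply/measurable_EFinP; exact: (measurableT_comp (@measurable_ln R)).
pose D1 z := maxe (psi z) 0%E.
pose D2 z := maxe (- (ln (g z))%:E)%E 0%E.
have D10 z : (0 <= D1 z)%E by rewrite le_max lexx orbT.
have D20 z : (0 <= D2 z)%E by rewrite le_max lexx orbT.
have mD1 : measurable_fun (Y `*` X) D1.
  by apply: measurable_maxe => //; exact: measurable_cst.
have mD2 : measurable_fun (Y `*` X) D2.
  apply: measurable_maxe; last exact: measurable_cst.
  by apply: measurableT_comp mlng.
have mD : measurable_fun (Y `*` X) D.
  apply: emeasurable_funD; last exact: measurable_cst.
  exact: emeasurable_funD.
have ID1 : (\int[F]_(z in Y `*` X) D1 z < +oo)%E.
  have mneg : measurable_fun (Y `*` X) (fun z => maxe (- psi z) 0)%E.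
    apply: measurable_maxe; last exact: measurable_cst.
    by apply: measurableT_comp mpsi.
  have psi_neg : (\int[F]_(z in Y `*` X) maxe (- psi z) 0 = 0)%E.
    apply: etrans (dis _ mneg _).2 _.
      by move=> z _; rewrite le_max lexx orbT.
    apply: integral0_eq => x Xx; apply: integral0_eq => y Yy.
    have YXyx : (Y `*` X) (y, x) by [].
    have := f0 y x Xx; rewrite le_eqVlt => /predU1P[<-|fy0]; first by rewrite mule0.
    rewrite (_ : maxe _ _ = 0%E) ?mul0e//.
    apply/max_idPr; rewrite oppe_le0 lne_ge0 /=.
    have := i0 _ YXyx; rewrite le_eqVlt => /predU1P[<-|iyx].
      by rewrite inve0 gt0_muley ?leey// lte_fin.
    rewrite inver gt_eqF// -EFinM lee_fin ler_pdivlMr// mul1r.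
    exact: (i_le _ YXyx).
  move: Cint; rewrite integral_maxE.
  by rewrite [X in (_ - X < _)%E -> _]psi_neg sube0.
have ID2 : (\int[F]_(z in Y `*` X) D2 z < +oo)%E.
  move: phi_r_int; rewrite integral_maxE.
  rewrite [X in (`|X - _| < _)%E -> _](_ : _ = 0%E).
    rewrite sub0e abseN gee0_abs//.
    by apply: integral_ge0 => z _; rewrite le_max lexx orbT.
  apply: integral0_eq => -[y x] [/= Yy Xx]; apply/max_idPr.
  rewrite lee_fin ln_le0// (le_trans (phi_r _ _ Yy Xx))//.
  by rewrite invf_le1// ler1n.
have ID : (\int[F]_(z in Y `*` X) D z < +oo)%E.
  rewrite (_ : (fun z => D z) = (fun z => D1 z + D2 z + (core_const R)%:E)%E)//.
  have K0 : 0 <= core_const R by rewrite le_max lexx orbT.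
  rewrite ge0_integralD//; last 2 first.
  - by move=> z _; rewrite adde_ge0.
  - exact: emeasurable_funD.
  rewrite ge0_integralD// integral_cst// lte_add_pinfty//.
    exact: lte_add_pinfty.
  rewrite lte_mul_pinfty ?lee_fin//.
  by rewrite (le_lt_trans (probability_le1 F mYX)) ?ltry.
pose G x := (\int[lebesgue_measure]_(y in Y) (D (y, x) * (f y x)%:E))%E.
have [mG IG] := dis _ mD (fun z _ => D0 z).
pose gL m x := (\int[lebesgue_measure]_(y in Y) (L m (y, x) * (f y x)%:E))%E.
pose gN m x := (\int[lebesgue_measure]_(y in Y) (N m (y, x) * (f y x)%:E))%E.
have disL m (m0 : (0 < m)%N) := dis _ (mL m m0) (fun z _ => L0 m z).
have disN m (m0 : (0 < m)%N) := dis _ (mN m m0) (fun z _ => N0 m z).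
have gL0 m x : X x -> (0 <= gL m x)%E.
  move=> Xx; apply: integral_ge0 => y _.
  by rewrite mule_ge0// lee_fin; exact: f0.
have G0 x : X x -> (0 <= G x)%E.
  move=> Xx; apply: integral_ge0 => y _.
  by rewrite mule_ge0// lee_fin; exact: f0.
have gLE m x : (0 < m)%N -> X x -> gL m x =
    (\int[lebesgue_measure]_(y in Y)
      (log_excess (f^~ x) (mix m x) y * (f y x)%:E))%E.
  by move=> m0 Xx; apply: eq_integral => y _; rewrite LE.
have mDx x : X x -> measurable_fun Y
    (majorant (f^~ x) (C^~ x) (sigma0 x) (r x)).
  by move=> Xx; exact: (measurable_slice mY mX mD Xx).
(* The model has mass m p_m + (1 - m p_m) = 1 on the real line. *)
have negpart_le m : (0 < m)%N ->
    (\int[Q]_(x in X) gN m x <= \int[Q]_(x in X) gL m x)%E.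
  move=> m0; apply: ge0_le_integral => //.
  - move=> x Xx; apply: integral_ge0 => y _.
    by rewrite mule_ge0// lee_fin; exact: f0.
  - exact: (disN m m0).1.
  - exact: (disL m m0).1.
  - move=> x Xx; rewrite gLE//.
    rewrite /gN; under eq_integral do rewrite NE//.
    apply: gibbs => //.
    + exact: mfx.
    + exact: measurable_mixture.
    + by move=> y; exact: f0.
    + by move=> y; exact: mix_gt0.
    + by apply: (mass_support (f := f^~ x)); [exact: f1|move=> y; exact: foff].
    + rewrite -[leRHS](_ : (m%:R * p m + q m)%:E = 1%E); last first.
        by rewrite /q addrC subrK.
      rewrite -(integral_mixture (mu m ^~ x) (sigma m x) (sigma0 x)); last 2 first.
        exact/ltW/p0.
        exact: q0.
      apply: ge0_subset_integral => //.
        apply/measurable_EFinP; exact: measurable_mixture.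
      by move=> y _; rewrite lee_fin ltW// mix_gt0.
    + exact: mLx.
    + exact: mNx.
(* From some m on the bandwidths are small in all slices at once. *)
have half0 : 0 < 2^-1 :> R by rewrite invr_gt0.
have [M1 _ sM] := cvge0_near_le sup_sigma_r half0.
have [M2 _ hM] := cvge0_near_le sup_h_sigma (@ltr01 R).
pose M := maxn (maxn M1 M2) 1.
have big m x : (M <= m)%N -> X x ->
    [/\ (0 < m)%N, 2 * sigma m x <= r x & h m x <= sigma m x].
  rewrite !geq_max => /andP[/andP[M1m M2m] m0] Xx; split => //.
    have := le_trans (ereal_sup_ubound (imageP _ Xx)) (sM m M1m).
    by rewrite lee_fin ler_pdivrMr ?r_gt0// => ?; lra.
  have := le_trans (ereal_sup_ubound (imageP _ Xx)) (hM m M2m).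
  by rewrite lee_fin ler_pdivrMr ?sigma_gt0// mul1r.
have M0 m : (M <= m)%N -> (0 < m)%N by rewrite !geq_max => /andP[_].
have Goo : (\int[Q]_(x in X) G x < +oo)%E by rewrite -IG.
have GQ : Q.-integrable X G.
  apply/integrableP; split => //.
  by rewrite (eq_integral G)// => x /[!inE] Xx; rewrite gee0_abs// G0.
have IGL : (\int[Q]_(x in X) gL m x)%E @[m --> \oo] --> 0%E.
  apply: (@dominated_cvg_to0 _ _ _ Q X gL (fun x => G x + 6%:E)%E M) => //.
  - by move=> m /M0 m0; exact: (disL m m0).1.
  - by move=> m x _; exact: gL0.
  - have contQ := ae_slice mY mX FYX f0 foff mf FE fcont.
    have Gfin := integrable_ae mX GQ.
    apply: filterS2 contQ Gfin => x contx Gx Xx.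
    apply: (@cvg_trans _ ((fun m => \int[lebesgue_measure]_(y in Y)
      (log_excess (f^~ x) (mix m x) y * (f y x)%:E))%E @ \oo)).
      by apply: near_eq_cvg; exists 1%N => // m m0; rewrite gLE.
    have sigma_cvg0 : sigma m x @[m --> \oo] --> (0 : R).
      rewrite -(mulr0 (0 : R)).
      apply: cvg_trans (cvgM (sigma_delta0 x Xx) (delta0 x Xx)).
      apply: near_eq_cvg; exists 1%N => // m m0 /=.
      by rewrite divfK// gt_eqF// delta_gt0.
    apply: (@log_excess_cvg0 _ (f^~ x) Y (fun m j => A m j x)
      (fun m => mu m ^~ x) (sigma^~ x) (h^~ x) p (sigma0 x) (r x) (C^~ x)) => //.
    + exact: mfx.
    + by move=> y; exact: f0.
    + exact: f1.
    + by move=> y; exact: foff.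
    + by move=> m j jm; exact: Aitv.
    + by move=> m m0; exact: Uitv.
    + by move=> m n mn; exact: Uincr.
    + by move=> m m0; exact: AY.
    + by move=> m m0; exact: Adisj.
    + by move=> m j jm; exact: muP.
    + by move=> m j jm; exact: hP.
    + by move=> m j jm; exact: Fj.
    + by move=> m m0; exact: F0.
    + by move=> m m0; exact/ltW/p0.
    + by move=> m m0; exact: sigma_gt0.
    + by move=> m m0; exact/ltW/h_gt0.
    + exact: sigma0_gt0.
    + exact: h_sigma0.
    + exact: r_gt0.
    + by move=> y Yy; have [[]] := CP y x Yy Xx.
    + by move=> y Yy; have [[]] := CP y x Yy Xx.
    + by move=> y Yy; have [] := CP y x Yy Xx.
    + exact: contx.
    + by move=> m m0; exact: mLx.
    + exact: mDx.
    + by have := Gx Xx; rewrite ge0_fin_numE// G0.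
  - by apply: emeasurable_funD => //; exact: measurable_cst.
  - move=> m x Mm Xx; have [m0 sr hs] := big m x Mm Xx; rewrite gLE//.
    apply: (@log_excess_integral_bound _ (f^~ x) Y (fun j => A m j x)
      (mu m ^~ x) m (sigma m x) (h m x) (p m) (q m) (sigma0 x) (r x) (C^~ x)).
    + exact: mfx.
    + by move=> y; exact: f0.
    + exact: f1.
    + exact: mY.
    + by move=> j jm; exact: Aitv.
    + exact: Uitv.
    + exact: AY.
    + exact: Adisj.
    + by move=> j jm; exact: muP.
    + by move=> j jm; exact: hP.
    + by move=> j jm; exact: Fj.
    + exact: F0.
    + exact: sigma_gt0.
    + exact: sigma0_gt0.
    + exact/ltW/p0.
    + exact: hs.
    + exact: sr.
    + by move=> y Yy; have [[]] := CP y x Yy Xx.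
    + by move=> y Yy; have [[]] := CP y x Yy Xx.
    + by move=> y Yy; have [] := CP y x Yy Xx.
    + exact: r_gt0.
    + exact: mLx.
    + exact: mDx.
  - rewrite ge0_integralD//.
    rewrite integral_cst// lte_add_pinfty//.
    rewrite lte_mul_pinfty ?lee_fin//.
    by rewrite (le_lt_trans (probability_le1 Q mX)) ?ltry.
have dKLE m : (0 < m)%N -> dKL F Y X f (model4 f A mu sigma sigma0 m) =
    (\int[Q]_(x in X) gL m x - \int[Q]_(x in X) gN m x)%E.
  move=> m0; rewrite /dKL integral_maxE; congr (_ - _)%E.
    exact: (disL m m0).2.
  exact: (disN m m0).2.
have IGN0 m : (0 <= \int[Q]_(x in X) gN m x)%E.
  apply: integral_ge0 => x Xx; apply: integral_ge0 => y _.
  by rewrite mule_ge0// lee_fin; exact: f0.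
have [M3 _ IM] := cvge0_near_le IGL (@ltr01 R).
apply: (@squeeze_cvge _ _ _ _ (cst 0%E) _ (fun m => \int[Q]_(x in X) gL m x)%E) => //.
- exists (maxn M3 1) => // m /=; rewrite geq_max => /andP[M3m m0].
  have gLfin : (\int[Q]_(x in X) gL m x)%E \is a fin_num.
    rewrite ge0_fin_numE; last by apply: integral_ge0 => x; exact: gL0.
    by apply: le_lt_trans (IM m M3m) _; rewrite ltry.
  have gNfin : (\int[Q]_(x in X) gN m x)%E \is a fin_num.
    rewrite ge0_fin_numE//; apply: le_lt_trans (negpart_le m m0) _.
    by rewrite ltey_eq gLfin.
  rewrite dKLE// sube_ge0 ?gNfin ?orbT// negpart_le//=.
  by rewrite leeBlDr// leeDl.
- exact: cvg_cst.
Qed.
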